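(* Let $\lambda>0$ and $t\ge 0$. The limit $$\alpha(t,\lambda) = \lim_{n \to \infty} \frac{\mathcal{K}(t,n,\lambda)}{n}$$ exists, satisfies $$ \lim_{n \to \infty} \frac{\mathcal{C}(t,n, \lambda)}{n} = \alpha(t,\lambda), $$ and is given by $$\alpha(t,\lambda) = 1 - \int_{e^{-\lambda t}}^1 e^{2(\varphi(u)- \varphi(1)) }\, \hat q\left(t+\frac{\ln u}{\lambda}, u\right) du - \left(m-(m-1)e^{-\lambda t}\right) e^{2(\varphi(e^{-\lambda t}) - \varphi(1)) - \lambda t(m-\varphi'(1))},$$ where $$\varphi(y)=\sum_{i=1}^{m-1}\frac{\overline{F}(i)}{i}y^i, \qquad \overline{F}(i) = 1 - F(i),$$ and $$\hat q(s,v) = 2 v^{m-\varphi'(1)-1} (1-v) \sum_{i=1}^{m-1} \mathcal{R}(s, i,\lambda) - 2(1-v)^2 \sum_{i=1}^{m-1} \mathcal{R}(s, i,\lambda) \sum_{j=m-i}^{m-1} \overline{F}(j) v^{i+j - \varphi'(1)-1}.$$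
   Context: Discrete sequential packing. Fix $m\in\mathbb{N}_+$ and a probability distribution supported on $\{1,\dots,m\}$ (the bundle size distribution; $m$ is the maximum bundle size), with mass function $f(k)=P(B=k)$ and distribution function $F(k)=P(B\le k)$. Line model: there are $n$ packages at locations $1,\dots,n$ on a line, all available at time $0$. To each location $i$ is attached a Poisson process of rate $\lambda>0$; the processes at different locations are independent, and each point of each process carries a mark (bundle size); all marks are i.i.d. with distribution $F$ and independent of all the Poisson processes. A point of the process at location $i$ with mark $k$ is a request for the packages at locations $i,i+1,\dots,i+k-1$. The request is accepted if $i+k-1\le n$ and all these packages are still available at that time, in which case all $k$ of them are picked up (removed permanently); otherwise it is rejected and nothing changes. $\mathcal{K}(t,n,\lambda)$ denotes the expected number of packages picked up during $[0,t]$, and $\mathcal{R}(t,n,\lambda)=n-\mathcal{K}(t,n,\lambda)$. Circle model: the same, except that the $n$ locations are arranged on a circle (locations are taken modulo $n$), and a request of size $k$ at $i$ is accepted if $k\le n$ and the packages at $i,i+1,\dots,i+k-1$ (modulo $n$) are all available. $\mathcal{C}(t,n,\lambda)$ denotes the expected number of packages picked up during $[0,t]$ in the circle model. Empty sums equal $0$. *)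

(* Defs.v *)
From HB Require Import structures.
From mathcomp Require Import all_boot all_order all_algebra.
From mathcomp Require Import all_classical all_reals all_analysis.

Set Implicit Arguments.
Unset Strict Implicit.
Unset Printing Implicit Defensive.

Import Order.TTheory GRing.Theory Num.Theory.
Import numFieldNormedType.Exports.

Local Open Scope classical_set_scope.
Local Open Scope ring_scope.

Definition is_bundle_pmf (R : realType) (m : nat) (f : nat -> R) : Prop :=
  [/\ forall k, 0 <= f k,
      forall k, ~~ (1 <= k <= m)%N -> f k = 0
    & \sum_(1 <= k < m.+1) f k = 1].

Definition bundle_cdf (R : realType) (f : nat -> R) (k : nat) : R :=
  \sum_(j < k.+1) f j.

Definition bundle_tail (R : realType) (f : nat -> R) (k : nat) : R :=
  1 - bundle_cdf f k.

Definition independent_systems d (T : measurableType d) (R : realType)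
    (P : probability T R) (I : eqType) (G : I -> set (set T)) : Prop :=
  forall (s : seq I) (A : I -> set T),
    uniq s -> (forall i, i \in s -> G i (A i)) ->
    P (\bigcap_(i in [set` s]) A i) = (\prod_(i <- s) fine (P (A i)))%:E.

Definition rv_system d d' (T : measurableType d) (T' : measurableType d')
    (X : T -> T') : set (set T) :=
  preimage_set_system setT X measurable.

Definition process_system d (T : measurableType d) (R : realType)
    (N : R -> T -> nat) : set (set T) :=
  <<s \bigcup_(u in [set u | 0 <= u]) rv_system (N u) >>.

(* N u is the number of points in [0, u]; only u >= 0 is meaningful. *)
Record is_poisson_process d (T : measurableType d) (R : realType)
    (P : probability T R) (lambda : R) (N : R -> T -> nat) : Prop := {
  poisson_measurable : forall u, 0 <= u -> measurable_fun setT (N u);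
  poisson_start : forall w, N 0 w = 0%N;
  poisson_nondecreasing : forall w u v, 0 <= u -> u <= v -> (N u w <= N v w)%N;
  poisson_right_continuous : forall w u, 0 <= u ->
    \forall v \near u^'+, N v w = N u w;
  poisson_increment_law : forall u v k, 0 <= u -> u < v ->
    P [set w | (N v w - N u w)%N = k] =
      (poisson_pmf (lambda * (v - u)) k)%:E;
  poisson_increment_independent : forall r : nat -> R, 0 <= r 0%N ->
    (forall l, r l <= r l.+1) ->
    independent_systems P
      (fun l => rv_system (fun w => (N (r l.+1) w - N (r l) w)%N))
}.

(* Requests at n locations: the location written i + 1 on paper is the ordinal
   i : 'I_n, and mark i k is the mark of the k-th point (counting from 0) of the
   process at i. *)
Record request_model (R : realType) (n : nat) (lambda : R) (f : nat -> R) := {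
  disp : measure_display;
  sample : measurableType disp;
  prob : probability sample R;
  num_points : 'I_n -> R -> sample -> nat;
  mark : 'I_n -> nat -> sample -> nat;
  num_points_poisson : forall i, is_poisson_process prob lambda (num_points i);
  mark_measurable : forall i k, measurable_fun setT (mark i k);
  mark_law : forall i k b, prob [set w | mark i k w = b] = (f b)%:E;
  request_independent :
    independent_systems prob
      (fun x : 'I_n + 'I_n * nat =>
         match x with
         | inl i => process_system (num_points i)
         | inr (i, k) => rv_system (mark i k)
         end)
}.

Section dynamics.
Variables (R : realType) (n : nat) (lambda : R) (f : nat -> R).
Variable M : request_model n lambda f.

(* Time of the k-th point at location i; it is only used for points that
   occur, i.e. when k < num_points i t w for some t. *)
Definition arrival (w : sample M) (i : 'I_n) (k : nat) : R :=
  inf [set u | 0 <= u /\ (k < num_points i u w)%N].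

(* The pairs (location, mark) of the requests arriving in [0, t], in
   chronological order. Simultaneous points have probability 0. *)
Definition requests (t : R) (w : sample M) : seq ('I_n * nat) :=
  [seq (p.1, mark p.1 p.2 w) |
     p <- sort (fun p q => arrival w p.1 p.2 <= arrival w q.1 q.2)
            [seq (i, k) | i <- enum 'I_n, k <- iota 0 (num_points i t w)]].

Definition line_fits (i : 'I_n) (k : nat) : bool := (i + k <= n)%N.
Definition line_bundle (i : 'I_n) (k : nat) : {set 'I_n} :=
  finset (fun j : 'I_n => (i <= j < i + k)%N).

Definition circle_fits (i : 'I_n) (k : nat) : bool := (k <= n)%N.
Definition circle_bundle (i : 'I_n) (k : nat) : {set 'I_n} :=
  finset (fun j : 'I_n => [exists l : 'I_k, val j == (i + l) %% n]%N).

Definition serve (fits : 'I_n -> nat -> bool)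
    (bundle : 'I_n -> nat -> {set 'I_n})
    (A : {set 'I_n}) (r : 'I_n * nat) : {set 'I_n} :=
  if fits r.1 r.2 && (bundle r.1 r.2 \subset A)
  then (A :\: bundle r.1 r.2)%SET else A.

Definition picked_up (fits : 'I_n -> nat -> bool)
    (bundle : 'I_n -> nat -> {set 'I_n}) (t : R) (w : sample M) : nat :=
  #|(~: foldl (serve fits bundle) [set: 'I_n] (requests t w))%SET|.

Definition expected_picked_up (fits : 'I_n -> nat -> bool)
    (bundle : 'I_n -> nat -> {set 'I_n}) (t : R) : R :=
  fine ('E_(prob M) [fun w => (picked_up fits bundle t w)%:R])%E.

Definition line_picked : R -> R := expected_picked_up line_fits line_bundle.

Definition line_remaining (t : R) : R := n%:R - line_picked t.

Definition circle_picked : R -> R :=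
  expected_picked_up circle_fits circle_bundle.

End dynamics.

Section density.
Variables (R : realType) (m : nat) (f : nat -> R).
(* remaining s i stands for the expected number of packages left at time s on a line
   of i packages. *)
Variable remaining : R -> nat -> R.

Definition varphi (y : R) : R :=
  \sum_(1 <= i < m) bundle_tail f i / i%:R * y ^+ i.

Definition q_hat (s v : R) : R :=
  2 * v `^ (m%:R - derive1 varphi 1 - 1) * (1 - v) * \sum_(1 <= i < m) remaining s i
  - 2 * (1 - v) ^+ 2 *
    \sum_(1 <= i < m) (remaining s i *
      \sum_(m - i <= j < m)
        bundle_tail f j * v `^ (i%:R + j%:R - derive1 varphi 1 - 1)).

Definition alpha (t lambda : R) : R :=
  1
  - \int[lebesgue_measure]_(u in `[expR (- (lambda * t)), 1])
      (expR (2 * (varphi u - varphi 1)) * q_hat (t + ln u / lambda) u)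
  - (m%:R - (m%:R - 1) * expR (- (lambda * t))) *
    expR (2 * (varphi (expR (- (lambda * t))) - varphi 1)
          - lambda * t * (m%:R - derive1 varphi 1)).

End density.

(* Main.v *)
Require Import Defs.
From mathcomp Require Import all_boot all_order all_algebra.
From mathcomp Require Import all_classical all_reals all_analysis.
From mathcomp Require Import measurable_realfun ring lra zify.
Set Implicit Arguments.
Unset Strict Implicit.
Unset Printing Implicit Defensive.
Import Order.TTheory GRing.Theory Num.Theory.
Import numFieldNormedType.Exports.
Local Open Scope classical_set_scope.
Local Open Scope ring_scope.

(** The set [A] of available packages is a Markov jump process: a request [r]
    turns [A] into [serve A r]. Cut [[0, t]] into [N] equal cells. Up to an
    event whose probability tends to [0] with [1 / N], every cell contains at
    most one request, all locations taken together, and the sample is then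
    described by a word of [N] letters which determines the chronological list
    of requests ([requests_of_code]). Such words have product probabilities
    ([code_event_prob]), so averaging over them is iterating an Euler step of
    the generator [G] of the process ([iter_euler_words]); in the limit the
    expectation of a function [h] of the available set is [e^(t G) h]
    ([cvg_iter_euler], [expected_picked_upE]).

    A request accepted inside an interval of available packages splits it into
    two intervals which no later request can touch simultaneously. Hence
    [G^N #|.|] is additive over them, and on an interval it depends on the length
    only ([iter_generator_chart]); this holds on a line and on a proper arc of a
    circle alike. Let [rho_n] be the mean number of packages left at a given
    time on a line of [n] packages. With [tau] the sum of the tails [Fbar i],
    [0 < i < m], so that the mean size is [1 + tau], for [n >= m]
      [rho_n' = lambda (2 sum_b f b (rho_0 + ... + rho_(n - b)) - (n - tau) rho_n)].

    Set [rho_n] to [0] for [n < m] and take second differences [k_n]. The long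
    sums disappear ([is_derive_curvature]):
      [k_n' = lambda (- (n - tau) k_n - 2 sum_i Fbar i k_(n - i) + source)],
    where the source involves [rho_i], [i < m], and vanishes for large [n]. The
    damping rate grows with [n], hence [k_n] tends to [0] uniformly in time
    ([curvature_vanishes]). Let [Psi_N(s, u)] be the sum of the [k_n(s) u^n],
    [n <= N]. Along the characteristic [s = t + ln u / lambda], the terms
    [n k_n u^n] cancel and [Psi_N] satisfies a scalar linear equation with
    integrating factor [u^(- tau) e^(2 (phi u - phi 1))], up to an error made of
    the last [m] coefficients ([is_derive_potential]). At [u = 1] it equals
    [rho_N - rho_(N - 1)] at time [t]; at [u = e^(- lambda t)] it is explicit,
    as [rho_n] is [n] at time [0]. Integrating between these two points and
    letting [N] tend to infinity shows that [rho_N - rho_(N - 1)] tends to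
    [1 - alpha] ([cvg_gap_increment]), and so does [rho_N / N].

    On a circle of [n] packages the first accepted request leaves a line, so the
    mean [v] of what is left satisfies
      [v' = lambda n (sum_b f b rho_(n - b) - v)].
    The rate [lambda n] keeps [v] within [m] of the average of the [rho_(n - b)]
    ([circle_mean_near]), hence [v / n] has the same limit. *)

(** * Exponential generating functions and pointwise derivatives *)

Section egf.
Variable R : realType.
Implicit Types (a b : nat -> R) (x : R).

Lemma cvgn_norm_le (u : nat -> R) l c : u n @[n --> \oo] --> l ->
  (forall n, `|u n| <= c) -> `|l| <= c.
Proof.
move=> /cvg_norm ul uc; rewrite -(cvg_lim _ ul)//.
by apply: limr_le; [exact: cvgP ul | exact: nearW].
Qed.

Definition geom_bounded a :=
  exists C K : R, [/\ 0 <= C, 0 <= K & forall N, `|a N| <= C * K ^+ N].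

(** At a fixed state, [e^(t G) h] is such a series, with [a N = (G^N h) s]. *)
Definition egf a x : R := limn (pseries (fun N => a N / N`!%:R) x).

Lemma cvg_egf a x : geom_bounded a ->
  cvgn (pseries (fun N => a N / N`!%:R) x).
Proof.
move=> [C [K [C0 K0 aK]]]; apply: normed_cvg.
apply: (@series_le_cvg _ _ (fun N => C * exp_coeff (K * `|x|) N)) => [N|N|N|].
- exact: normr_ge0.
- by rewrite mulr_ge0// /exp_coeff divr_ge0// exprn_ge0// mulr_ge0.
- rewrite /exp_coeff /= normrM normrM normfV normr_nat normrX exprMn.
  rewrite [leLHS]mulrAC !mulrA ler_wpM2r ?invr_ge0//.
  by rewrite ler_wpM2r ?exprn_ge0.
- rewrite (_ : (fun N => _) = C *: exp_coeff (K * `|x|)) //.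
  exact/is_cvg_seriesZ/is_cvg_series_exp_coeff.
Qed.

Lemma geom_bounded_shift a : geom_bounded a -> geom_bounded (fun N => a N.+1).
Proof.
move=> [C [K [C0 K0 aK]]]; exists (C * K), K; split=> // [|N].
  exact: mulr_ge0.
by rewrite -mulrA -exprS.
Qed.

Lemma geom_boundedD a b : geom_bounded a -> geom_bounded b ->
  geom_bounded (fun N => a N + b N).
Proof.
move=> [C [K [C0 K0 aK]]] [D [L [D0 L0 bL]]]; exists (C + D), (K + L).
split=> [||N]; rewrite ?addr_ge0//.
apply: (le_trans (ler_normD _ _)); rewrite mulrDl lerD//.
  apply: (le_trans (aK N)); rewrite ler_wpM2l// lerXn2r ?nnegrE ?addr_ge0//.
  by rewrite lerDl.
apply: (le_trans (bL N)); rewrite ler_wpM2l// lerXn2r ?nnegrE ?addr_ge0//.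
by rewrite lerDr.
Qed.

Lemma geom_boundedZ c a : geom_bounded a -> geom_bounded (fun N => c * a N).
Proof.
move=> [C [K [C0 K0 aK]]]; exists (`|c| * C), K.
by split=> [||N]; rewrite ?mulr_ge0// normrM -mulrA ler_wpM2l.
Qed.

Lemma geom_bounded0 : geom_bounded (fun=> 0).
Proof. by exists 0, 0; split=> // N; rewrite normr0 mul0r. Qed.

Lemma geom_bounded_sum (I : Type) (r : seq I) (P : pred I) (F : I -> nat -> R) :
  (forall i, P i -> geom_bounded (F i)) ->
  geom_bounded (fun N => \sum_(i <- r | P i) F i N).
Proof.
move=> H; elim: r => [|i r IH].
  rewrite (_ : (fun N => _) = fun=> 0); first exact: geom_bounded0.
  by apply/funext => N; rewrite big_nil.
rewrite (_ : (fun N => _) = fun N => (if P i then F i N else 0) +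
    \sum_(i <- r | P i) F i N).
  case: (boolP (P i)) => Pi; apply: geom_boundedD => //; first exact: H.
  exact: geom_bounded0.
by apply/funext => N; rewrite big_cons; case: ifP => // _; rewrite add0r.
Qed.

(** The index shift [a N.+1] becomes one application of the generator when
    [a N = (G^N h) s]. *)
Lemma is_derive_egf a x : geom_bounded a ->
  is_derive x 1 (egf a) (egf (fun N => a N.+1) x).
Proof.
have diffs b : pseries_diffs (fun N => b N / N`!%:R) =
    (fun N => b N.+1 / N`!%:R).
  apply/funext => N; rewrite /pseries_diffs factS natrM invfM.
  by rewrite mulrCA mulVKf ?pnatr_eq0.
move=> ga; rewrite /egf -diffs; apply: (@pseries_snd_diffs _ _ (`|x| + 1)).
- exact: cvg_egf.
- by rewrite diffs; exact/cvg_egf/geom_bounded_shift.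
- rewrite diffs (diffs (fun N => a N.+1)); apply: cvg_egf.
  exact: (geom_bounded_shift (geom_bounded_shift ga)).
- by rewrite [ltRHS]ger0_norm// ltrDl.
Qed.

Lemma egfD a b x : geom_bounded a -> geom_bounded b ->
  egf (fun N => a N + b N) x = egf a x + egf b x.
Proof.
move=> ga gb; rewrite /egf -limD; [|exact: cvg_egf..].
congr (limn _); apply/funext => n; rewrite fctE /pseries /series/=.
by rewrite -big_split; apply: eq_bigr => i _; rewrite /= -mulrDl -mulrDl.
Qed.

Lemma egfZ c a x : geom_bounded a -> egf (fun N => c * a N) x = c * egf a x.
Proof.
move=> ga; apply: cvg_lim => //.
rewrite (_ : pseries _ _ = (fun n => c * pseries (fun N => a N / N`!%:R) x n)).
  by apply: cvgMl_tmp => //; exact: cvg_egf.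
apply/funext => n; rewrite /pseries /series/= mulr_sumr.
by apply: eq_bigr => i _; rewrite -!mulrA.
Qed.

Lemma egf_const_seq c x : egf (fun N => c *+ (N == 0)) x = c.
Proof.
apply: cvg_lim => //; rewrite -(cvg_shiftn 1) /=.
rewrite (_ : (fun n => _) = cst c); first exact: cvg_cst.
apply/funext => n; rewrite /pseries /series/= addn1 big_nat_recl//=.
by rewrite big1 ?addr0 ?fact0 ?divr1 ?mulr1// => i _; rewrite mulr0n !mul0r.
Qed.

Lemma egf_sum (I : Type) (r : seq I) (P : pred I) (F : I -> nat -> R) x :
  (forall i, P i -> geom_bounded (F i)) ->
  egf (fun N => \sum_(i <- r | P i) F i N) x = \sum_(i <- r | P i) egf (F i) x.
Proof.
move=> H; elim: r => [|i r IH].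
  rewrite big_nil -[RHS](egf_const_seq 0 x); congr egf; apply/funext => N.
  by rewrite big_nil mul0rn.
rewrite big_cons -IH; case: ifP => Pi.
  rewrite -egfD; [|exact: H|exact: geom_bounded_sum].
  by congr egf; apply/funext => N; rewrite big_cons Pi.
by congr egf; apply/funext => N; rewrite big_cons Pi.
Qed.

Lemma egf_at0 a : egf a 0 = a 0%N.
Proof.
apply: cvg_lim => //; rewrite -(cvg_shiftn 1) /=.
rewrite (_ : (fun n => _) = cst (a 0%N)); first exact: cvg_cst.
apply/funext => n; rewrite /pseries /series/= addn1 big_nat_recl//=.
by rewrite big1 ?addr0 ?fact0 ?divr1 ?mulr1// => i _; rewrite expr0n mulr0.
Qed.

End egf.

Lemma is_derive_continuous (R : realType) (f df : R -> R) :
  (forall x, is_derive x (1 : R) f (df x)) -> continuous f.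
Proof.
move=> fd x; apply: differentiable_continuous; apply/derivable1_diffP.
exact: (@ex_derive _ _ _ _ _ _ _ (fd x)).
Qed.

Lemma mean_value_le (R : realType) (f df : R -> R) (a b B : R) : a <= b ->
  (forall x, is_derive x (1 : R) f (df x)) ->
  (forall x, a <= x <= b -> `|df x| <= B) -> `|f b - f a| <= B * (b - a).
Proof.
rewrite le_eqVlt => /predU1P[-> _ _|ab fd dB]; first by rewrite !subrr normr0 mulr0.
have [|c] := @MVT _ f df a b ab (fun x _ => fd x).
  exact/continuous_subspaceT/(is_derive_continuous fd).
rewrite in_itv/= => /andP[ac cb] ->; rewrite normrM (gtr0_norm (_ : 0 < b - a)).
  apply: ler_wpM2r; first by rewrite subr_ge0 ltW.
  by apply: dB; rewrite !ltW.
by rewrite subr_gt0.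
Qed.

Section pointwise_derivatives.
Variable R : realType.
Implicit Types (f g : R -> R) (x a b : R).

Lemma is_derive_rewrite f x a b : is_derive x (1 : R) f a -> a = b ->
  is_derive x (1 : R) f b.
Proof. by move=> + <-. Qed.

Lemma is_derive_addf f g x a b : is_derive x (1 : R) f a ->
  is_derive x (1 : R) g b -> is_derive x (1 : R) (fun y => f y + g y) (a + b).
Proof. by move=> fa gb; exact: is_deriveD. Qed.

Lemma is_derive_subf f g x a b : is_derive x (1 : R) f a ->
  is_derive x (1 : R) g b -> is_derive x (1 : R) (fun y => f y - g y) (a - b).
Proof. by move=> fa gb; exact: is_deriveB. Qed.

Lemma is_derive_mulf f g x a b : is_derive x (1 : R) f a ->
  is_derive x (1 : R) g b ->
  is_derive x (1 : R) (fun y => f y * g y) (a * g x + f x * b).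
Proof.
move=> fa gb; have D : is_derive x (1 : R) (fun y => f y * g y) (f x *: b + g x *: a).
  exact: is_deriveM.
apply: is_derive_rewrite D _.
by rewrite addrC /GRing.scale/= [g x * a]mulrC.
Qed.

Lemma is_derive_scalef f x a c : is_derive x (1 : R) f a ->
  is_derive x (1 : R) (fun y => c * f y) (c * a).
Proof. by move=> fa; exact: is_deriveZ. Qed.

Lemma is_derive_sumf (I : Type) (r : seq I) (P : pred I) (F : I -> R -> R) dF x :
  (forall i, P i -> is_derive x (1 : R) (F i) (dF i)) ->
  is_derive x (1 : R) (fun y => \sum_(i <- r | P i) F i y)
    (\sum_(i <- r | P i) dF i).
Proof.
move=> FdF; elim: r => [|i r IH].
  rewrite big_nil (_ : (fun y => _) = cst 0); first exact: is_derive_cst.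
  by apply/funext => y; rewrite big_nil.
rewrite big_cons; case: ifP => Pi.
  rewrite (_ : (fun y => _) =
    fun y => F i y + \sum_(i <- r | P i) F i y).
    exact: is_derive_addf (FdF _ Pi) IH.
  by apply/funext => y; rewrite big_cons Pi.
rewrite (_ : (fun y => _) = fun y => \sum_(i <- r | P i) F i y) //.
by apply/funext => y; rewrite big_cons Pi.
Qed.

Lemma is_derive_compf f g x a b : is_derive (g x) (1 : R) f a ->
  is_derive x (1 : R) g b -> is_derive x (1 : R) (fun y => f (g y)) (a * b).
Proof. by move=> fa gb; exact: is_derive1_comp. Qed.

Lemma is_derive_expf x n :
  is_derive x (1 : R) (fun y => y ^+ n) (n%:R * x ^+ n.-1).
Proof.
elim: n => [|n IH].
  rewrite mul0r (_ : (fun y => _) = cst 1); first exact: is_derive_cst.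
  by apply/funext => y; rewrite expr0.
rewrite (_ : (fun y => _) = fun y => y * y ^+ n); last first.
  by apply/funext => y; rewrite exprS.
apply: is_derive_rewrite (is_derive_mulf (is_derive_id x 1) IH) _.
case: n {IH} => [|n] /=; first by rewrite !expr0; ring.
by rewrite exprS -!natr1; ring.
Qed.

End pointwise_derivatives.

(** * The semigroup of a bounded-rate jump process and its Euler scheme *)

Section jump.
Variables (R : realType) (S : Type) (X : finType) (p : X -> R) (act : S -> X -> S).
Hypothesis p_ge0 : forall x, 0 <= p x.
Implicit Types (h : S -> R) (s : S) (c t T a d : R).

(** The process leaves [s] for [act s x] at rate [p x]; letters [x] with
    [act s x = s] are allowed and do not count as jumps in [generator]. *)
Definition total_rate : R := \sum_x p x.
Definition generator h s : R := \sum_x p x * (h (act s x) - h s).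
Definition semigroup h (t : R) s : R := egf (fun N => iter N generator h s) t.
Definition sup_bounded h c := forall s, `|h s| <= c.

Let L := total_rate.

Lemma total_rate_ge0 : 0 <= L. Proof. exact: sumr_ge0. Qed.

Lemma generator_bounded h c : sup_bounded h c ->
  sup_bounded (generator h) (2 * L * c).
Proof.
move=> hc s; apply: (le_trans (ler_norm_sum _ _ _)).
rewrite mulrAC mulr_sumr ler_sum// => x _.
rewrite normrM ger0_norm// mulrC ler_wpM2r//.
apply: (le_trans (ler_normB _ _)); rewrite mulrDl mul1r; exact: lerD.
Qed.

Lemma iter_generator_bounded h c N : sup_bounded h c ->
  sup_bounded (iter N generator h) (c * (2 * L) ^+ N).
Proof.
move=> hc; elim: N => [|N IH]; first by rewrite expr0 mulr1.
by rewrite exprS mulrCA; exact: generator_bounded.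
Qed.

Lemma sup_bound_ge0 h c (s : S) : sup_bounded h c -> 0 <= c.
Proof. by move=> /(_ s); apply: le_trans. Qed.

Lemma geom_iter_generator h c s : sup_bounded h c ->
  geom_bounded (fun N => iter N generator h s).
Proof.
move=> hc; exists c, (2 * L); split => [||N].
- exact: sup_bound_ge0 s hc.
- by rewrite mulr_ge0// total_rate_ge0.
- exact: iter_generator_bounded.
Qed.

(** The equation [v' = G v] is used with [G] acting on the time-dependent
    function, whose values at other states are then analysed one by one. *)
Lemma semigroup_generator h c t s : sup_bounded h c ->
  semigroup (generator h) t s = generator (semigroup h t) s.
Proof.
move=> hc; rewrite /semigroup.
transitivity (egf (fun N => \sum_x (p x * (iter N generator h (act s x)
    + -1 * iter N generator h s))) t).
  congr egf; apply/funext => N; rewrite -iterSr; apply: eq_bigr => x _.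
  by rewrite mulN1r.
have gb r := geom_iter_generator r hc.
rewrite egf_sum => [|x _].
  apply: eq_bigr => x _; rewrite egfZ ?egfD ?egfZ ?mulN1r//.
    exact: geom_boundedZ.
  by apply: geom_boundedD => //; exact: geom_boundedZ.
by apply: geom_boundedZ; apply: geom_boundedD => //; exact: geom_boundedZ.
Qed.

Lemma is_derive_semigroup h c t s : sup_bounded h c ->
  is_derive t 1 (semigroup h ^~ s) (semigroup (generator h) t s).
Proof.
move=> hc; have := is_derive_egf t (geom_iter_generator s hc).
by congr (is_derive _ _ _ (egf _ _)); apply/funext => N; rewrite iterSr.
Qed.

Lemma semigroup0 h s : semigroup h 0 s = h s.
Proof. exact: egf_at0. Qed.

Lemma semigroup_cst_sub h c a t s : sup_bounded h c ->
  semigroup (fun s => a - h s) t s = a - semigroup h t s.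
Proof.
move=> hc; rewrite -mulN1r -[in RHS](egf_const_seq a t) /semigroup.
rewrite -egfZ; last exact: geom_iter_generator hc.
rewrite -egfD.
- congr egf; apply/funext => N; elim: N s => [|N IH] s /=.
    by rewrite mulr1n mulN1r.
  rewrite mulr0n add0r mulr_sumr; apply: eq_bigr => x _.
  rewrite !IH; ring.
- exists `|a|, 1; split => // N; rewrite expr1n mulr1; case: N => //=.
  by rewrite mulr0n normr0.
- exact/geom_boundedZ/geom_iter_generator/hc.
Qed.

(** Crude, but uniform on a time interval: it controls the second time derivative
    in the Euler scheme, from which the sharp [semigroup_bounded] follows. *)
Lemma semigroup_growth h c t T s : sup_bounded h c -> 0 <= t <= T ->
  `|semigroup h t s| <= c * expR (2 * L * T).
Proof.
move=> hc /andP[t0 tT].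
have c0 := sup_bound_ge0 s hc.
have cv := @cvg_egf _ _ t (geom_iter_generator s hc).
apply: cvgn_norm_le cv _ => n.
rewrite /pseries /series/=.
apply: (le_trans (ler_norm_sum _ _ _)).
apply: (@le_trans _ _ (\sum_(0 <= i < n) c * exp_coeff (2 * L * t) i)).
  apply: ler_sum => i _; rewrite /exp_coeff /= normrM normrM normfV normr_nat.
  rewrite normrX (ger0_norm t0) [_ ^+ i in leRHS]exprMn.
  rewrite [leLHS]mulrAC !mulrA ler_wpM2r ?invr_ge0//.
  rewrite ler_wpM2r ?exprn_ge0//; exact: iter_generator_bounded.
rewrite -mulr_sumr ler_wpM2l//.
apply: (@le_trans _ _ (expR (2 * L * t))); last first.
  by rewrite ler_expR ler_wpM2l// mulr_ge0// total_rate_ge0.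
apply: (nondecreasing_cvgn_le _ (@is_cvg_series_exp_coeff _ _)).
apply: nondecreasing_series => i _ _; rewrite /exp_coeff divr_ge0// exprn_ge0//.
by rewrite !mulr_ge0// total_rate_ge0.
Qed.

(** [L * d] is the mean number of letters in a time [d]; the weights are the
    Poisson probabilities of no letter and of one letter. *)
Definition euler (d : R) h s : R :=
  expR (- (L * d)) * (h s + d * \sum_x p x * h (act s x)).

Lemma euler_bounded d h c : 0 <= d -> sup_bounded h c ->
  sup_bounded (euler d h) c.
Proof.
move=> d0 hc s; have c0 := sup_bound_ge0 s hc.
rewrite /euler normrM ger0_norm ?expR_ge0//.
have : `|h s + d * \sum_x p x * h (act s x)| <= (1 + L * d) * c.
  apply: (le_trans (ler_normD _ _)); rewrite mulrDl mul1r lerD//.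
  rewrite normrM ger0_norm// [L * d]mulrC -mulrA ler_wpM2l// mulr_suml.
  apply: (le_trans (ler_norm_sum _ _ _)); apply: ler_sum => x _.
  by rewrite normrM ger0_norm// ler_wpM2l.
move=> /(ler_wpM2l (expR_ge0 (- (L * d)))) /le_trans; apply.
rewrite mulrA -[leRHS]mul1r ler_wpM2r// expRN mulrC ler_pdivrMr ?expR_gt0//.
by rewrite mul1r expR_ge1Dx// mulr_ge0// total_rate_ge0.
Qed.

Lemma iter_euler_bounded d h c N : 0 <= d -> sup_bounded h c ->
  sup_bounded (iter N (euler d) h) c.
Proof. by move=> d0 hc; elim: N => //= N IH; exact: euler_bounded. Qed.

Lemma eulerB d h k s : euler d h s - euler d k s = euler d (fun s => h s - k s) s.
Proof.
rewrite /euler -mulrBr; congr (_ * _).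
have -> : \sum_x p x * (h (act s x) - k (act s x)) =
  \sum_x p x * h (act s x) - \sum_x p x * k (act s x).
  by rewrite -sumrB; apply: eq_bigr => x _; rewrite mulrBr.
ring.
Qed.

(** Up to [O(d ^ 2)], an Euler step is [1 + d G]. *)
Lemma euler_generator d h s : euler d h s =
  expR (- (L * d)) * ((1 + L * d) * h s + d * generator h s).
Proof.
rewrite /euler /generator; congr (_ * _).
under [in RHS]eq_bigr do rewrite mulrBr.
rewrite sumrB -mulr_suml -/total_rate -/L; ring.
Qed.


Lemma semigroup_taylor h c r d T s : sup_bounded h c ->
  0 <= r -> 0 <= d -> r + d <= T ->
  `|semigroup h (r + d) s - semigroup h r s - d * semigroup (generator h) r s|
    <= 2 * L * (2 * L * c) * expR (2 * L * T) * d ^+ 2.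
Proof.
move=> hc r0 d0 rdT; set B := _ * expR _.
have gc := generator_bounded hc; have ggc := generator_bounded gc.
have inT x : r <= x <= r + d -> 0 <= x <= T by move=> /andP[? ?]; apply/andP; split; lra.
pose F x := semigroup h x s - x * semigroup (generator h) r s.
pose dF x := semigroup (generator h) x s - semigroup (generator h) r s.
have dFE x : is_derive x (1 : R) F (dF x).
  apply: is_derive_subf; first exact: is_derive_semigroup hc.
  apply: is_derive_rewrite (is_derive_mulf (is_derive_id _ _)
    (is_derive_cst _ _ _)) _; by rewrite mulr0 addr0 mul1r.
have -> : semigroup h (r + d) s - semigroup h r s
    - d * semigroup (generator h) r s = F (r + d) - F r by rewrite /F; ring.
have -> : B * d ^+ 2 = (B * d) * ((r + d) - r) by ring.
apply: (mean_value_le _ dFE) => [|x /[dup] xr /andP[rx xrd]]; first by rewrite lerDl.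
apply: (@le_trans _ _ (B * (x - r))).
  apply: (mean_value_le (f := semigroup (generator h) ^~ s) rx) => y.
    exact: is_derive_semigroup gc.
  move=> /andP[ry yx]; apply: semigroup_growth => //; apply: inT.
  by rewrite ry (le_trans yx).
rewrite ler_wpM2l ?lerBlDl// /B.
have L0 := total_rate_ge0; have := sup_bound_ge0 s hc => c0.
by rewrite !mulr_ge0// expR_ge0.
Qed.

(** Both sides agree to first order in [d]: the Poisson weights satisfy
    [e^(- x) (1 + x) = 1 + O(x ^ 2)], and [semigroup_taylor] expands the other
    side. *)
Lemma euler_local_error h c r d T s : sup_bounded h c ->
  0 <= r -> 0 <= d -> r + d <= T ->
  `|euler d (semigroup h r) s - semigroup h (r + d) s|
    <= 7 * L ^+ 2 * c * expR (2 * L * T) * d ^+ 2.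
Proof.
move=> hc r0 d0 rdT.
have rT : 0 <= r <= T by rewrite r0 (le_trans _ rdT)// lerDl.
have Ld0 : 0 <= L * d by rewrite mulr_ge0// total_rate_ge0.
have B0 := semigroup_growth s hc rT.
have B1 := semigroup_growth s (generator_bounded hc) rT.
have B2 := semigroup_taylor s hc r0 d0 rdT.
rewrite euler_generator -(semigroup_generator _ _ hc).
set u := semigroup h r s in B0 B2 *; set g := semigroup _ r s in B1 B2 *.
set v := semigroup h _ s in B2 *.
have e1 : expR (- (L * d)) <= 1 by rewrite -expR0 ler_expR oppr_le0.
have e2 : 1 - L * d <= expR (- (L * d)).
  by rewrite -[leLHS]/(1 + - (L * d)) expR_ge1Dx.
have e3 : expR (- (L * d)) * (1 + L * d) <= 1.
  by rewrite expRN mulrC ler_pdivrMr ?expR_gt0// mul1r expR_ge1Dx.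
set E := expR (- (L * d)) in e1 e2 e3 *.
have -> : E * ((1 + L * d) * u + d * g) - v =
  (E * (1 + L * d) - 1) * u + (E - 1) * d * g - (v - u - d * g) by ring.
have E1 : `|E * (1 + L * d) - 1| <= (L * d) ^+ 2.
  rewrite ler_norml; apply/andP; split; last nra.
  by nra.
have E2 : `|E - 1| <= L * d by rewrite ler_norml; apply/andP; split; lra.
(* The constant 7 is 1 + 2 + 4: the mass lost by the weights, the damping of
   the first-order term, and the Taylor remainder. *)
apply: (le_trans (ler_normB _ _)).
have T1 : `|(E * (1 + L * d) - 1) * u| <= (L * d) ^+ 2 * (c * expR (2 * L * T)).
  by rewrite normrM ler_pM.
have T2 : `|(E - 1) * d * g| <= (L * d) * d * (2 * L * c * expR (2 * L * T)).
  by rewrite 2!normrM ler_pM// (ger0_norm d0) ler_wpM2r.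
apply: (le_trans (lerD (ler_normD _ _) B2)).
apply: (le_trans (lerD (lerD T1 T2) (lexx _))).
by rewrite le_eqVlt; apply/orP; left; apply/eqP; ring.
Qed.

(** An Euler step is a contraction, so the local errors merely add up. *)
Lemma iter_euler_error h c t N s : sup_bounded h c -> 0 <= t ->
  `|iter N.+1 (euler (t / N.+1%:R)) h s - semigroup h t s|
    <= 7 * L ^+ 2 * c * expR (2 * L * t) * t ^+ 2 / N.+1%:R.
Proof.
move=> hc t0; set d := t / _; set C := _ * expR _.
have d0 : 0 <= d by rewrite divr_ge0.
have dt : N.+1%:R * d = t by rewrite mulrC divfK// pnatr_eq0.
suff H j : (j <= N.+1)%N -> forall s,
    `|iter j (euler d) h s - semigroup h (j%:R * d) s| <= j%:R * (C * d ^+ 2).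
  have := H _ (leqnn _) s; rewrite dt => /le_trans; apply.
  have : N.+1%:R != 0 :> R by rewrite pnatr_eq0.
  rewrite /d; move: (N.+1%:R) => k k0.
  by rewrite le_eqVlt; apply/orP; left; apply/eqP; field.
elim: j => [_ s'|j IH jN s'].
  by rewrite !mul0r semigroup0 subrr normr0.
have {}IH := IH (ltnW jN).
rewrite iterS -[in X in _ - X]natr1 mulrDl mul1r.
rewrite -(subrKA (euler d (semigroup h (j%:R * d)) s')) eulerB.
apply: (le_trans (ler_normD _ _)); rewrite -natr1 mulrDl mul1r lerD//.
  exact: euler_bounded.
apply: euler_local_error => //; first by rewrite mulr_ge0.
by rewrite -[X in _ + X]mul1r -mulrDl natr1 -dt ler_wpM2r// ler_nat.
Qed.

Lemma cvg_iter_euler h c t s : sup_bounded h c -> 0 <= t ->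
  iter N.+1 (euler (t / N.+1%:R)) h s @[N --> \oo] --> semigroup h t s.
Proof.
move=> hc t0; set C := 7 * L ^+ 2 * c * expR (2 * L * t) * t ^+ 2.
apply/cvgrPdist_le => e e0.
have : C * (N.+1%:R)^-1 @[N --> \oo] --> C * 0.
  by apply: cvgMl_tmp; exact: cvg_harmonic.
rewrite mulr0 => /cvgrPdist_le /(_ _ e0); apply: filterS => N.
rewrite sub0r normrN distrC => CN; apply: (le_trans (iter_euler_error N s hc t0)).
by rewrite (le_trans _ CN)// ler_norm.
Qed.

(** [e^(t G)] is a contraction because it is a limit of contractions. *)
Lemma semigroup_bounded h c t : sup_bounded h c -> 0 <= t ->
  sup_bounded (semigroup h t) c.
Proof.
move=> hc t0 s; apply: cvgn_norm_le (cvg_iter_euler (s := s) hc t0) _ => N.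
by apply: iter_euler_bounded => //; rewrite divr_ge0.
Qed.

Lemma semigroup_cst a t s : semigroup (fun=> a) t s = a.
Proof.
rewrite /semigroup -[RHS](egf_const_seq a t); congr egf; apply/funext.
case=> [|N]; first by rewrite mulr1n.
elim: N s => [|N IH] s; rewrite iterS /generator big1// => x _.
  by rewrite subrr mulr0.
by rewrite !IH subrr mulr0.
Qed.

Definition step s (o : option X) : S := if o is Some x then act s x else s.

Definition step_weight (d : R) (o : option X) : R :=
  expR (- (L * d)) * (if o is Some x then d * p x else 1).

(** One Euler step averages over at most one jump, so [N] of them average over
    all words of [N] letters, the letter [None] standing for no jump. *)
Lemma iter_euler_words d N h s : iter N (euler d) h s =
  \sum_(c : N.-tuple (option X))
    (\prod_(o <- c) step_weight d o) * h (foldl step s c).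
Proof.
elim: N s => [|N IH] s.
  rewrite (big_pred1 [tuple]) ?big_nil ?mul1r// => c; exact/esym/eqP/tuple0.
pose F (y : option X * N.-tuple (option X)) : N.+1.-tuple (option X) :=
  [tuple of y.1 :: y.2].
rewrite (reindex F) /=; last first.
  exists (fun c : N.+1.-tuple (option X) => (thead c, [tuple of behead c])) => [[q c] _|c _].
    by congr pair; apply: val_inj.
  by rewrite /F /= [RHS]tuple_eta.
transitivity (\sum_(o : option X) step_weight d o *
    iter N (euler d) h (step s o)).
  rewrite (bigD1 None)//= (reindex_omap Some id)/=; last by case.
  rewrite /step_weight mulr1 {1}/euler mulrDr; congr (_ + _).
  rewrite mulrA mulr_sumr; apply: eq_big => [x|x _]; first by rewrite eqxx.
  by rewrite -!mulrA.
transitivity (\sum_(q : option X) \sum_(c : N.-tuple (option X))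
    step_weight d q * (\prod_(o <- c) step_weight d o * h (foldl step (step s q) c))).
  by apply: eq_bigr => q _; rewrite IH mulr_sumr.
rewrite pair_bigA; apply: eq_bigr => -[q c] _ /=.
by rewrite big_cons mulrA.
Qed.

End jump.

(** * Reading the requests off a partition of the time interval *)

Lemma uniq_map_inj (T1 T2 : eqType) (g : T1 -> T2) s :
  uniq (map g s) -> {in s &, injective g}.
Proof.
elim: s => [//|x s IH] /= /andP[gx /IH {}IH] a b.
rewrite !inE => /predU1P[->|sa] /predU1P[->|sb] // gab; last exact: IH.
  by move: gx; rewrite gab map_f.
by move: gx; rewrite -gab map_f.
Qed.

Section codes.
Variable n : nat.
Implicit Types (c : seq (option ('I_n * nat))) (i : 'I_n).

(** A word [c] prescribes, for each cell of the partition, either no request or a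
    request with its location and mark; [pmap id c] is the list of requests. *)
Definition at_loc i (o : option ('I_n * nat)) : bool :=
  if o is Some x then x.1 == i else false.

Definition marks_at i (s : seq ('I_n * nat)) : seq nat :=
  [seq x.2 | x <- s & x.1 == i].

Lemma size_marks_at i c : size (marks_at i (pmap id c)) = count (at_loc i) c.
Proof.
rewrite /marks_at size_map size_filter; elim: c => //= -[x|] c IH //=.
by rewrite IH.
Qed.
End codes.

Section paths.
Variables (R : realType) (n : nat) (lambda : R) (f : nat -> R).
Variable M : request_model n lambda f.
Variable w : sample M.
Implicit Types (i : 'I_n) (u r : R) (p : 'I_n * nat).

Lemma arrival_le i k u : 0 <= u -> (k < num_points i u w)%N ->
  arrival w i k <= u.
Proof.
move=> u0 ku; apply: ge_inf; last by split.
by exists 0 => v [].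
Qed.

(** Right continuity makes the bound strict, so that points found in different
    cells have different times. *)
Lemma arrival_gt i k r u : 0 <= r -> (num_points i r w <= k)%N ->
  0 <= u -> (k < num_points i u w)%N -> r < arrival w i k.
Proof.
move=> r0 rk u0 ku; have mono := poisson_nondecreasing (num_points_poisson M i) w.
have [e /= e0 He] := poisson_right_continuous (num_points_poisson M i) w r0.
apply: (@lt_le_trans _ _ (r + e)); first by rewrite ltrDl.
apply: lb_le_inf; first by exists u; split.
move=> v [v0 kv]; rewrite leNgt; apply/negP => vre.
have rv : r < v.
  rewrite ltNge; apply/negP => /(mono _ _ v0) vr.
  by have := leq_trans kv (leq_trans vr rk); rewrite ltnn.
have := He v; rewrite /= => /(_ _ rv) Nv.
move: kv; rewrite Nv ?ltnNge ?rk//.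
by rewrite distrC ger0_norm ?subr_ge0 ?ltW// ltrBlDl.
Qed.

Variables (t : R) (N : nat) (c : seq (option ('I_n * nat))).
Hypothesis t0 : 0 <= t.
Let grid (l : nat) : R := l%:R * (t / N%:R).
Hypothesis increments_match : forall i l, (l < N)%N ->
  (num_points i (grid l.+1) w - num_points i (grid l) w)%N =
  at_loc i (nth None c l).
Hypothesis marks_match : forall i k,
  (k < size (marks_at i (pmap id c)))%N ->
  mark i k w = nth 0%N (marks_at i (pmap id c)) k.
Hypothesis size_c : size c = N.

Lemma grid_ge0 l : 0 <= grid l. Proof. by rewrite /grid mulr_ge0// divr_ge0. Qed.
Lemma grid_homo l l' : (l <= l')%N -> grid l <= grid l'.
Proof. by move=> ll'; rewrite /grid ler_wpM2r ?divr_ge0// ler_nat. Qed.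

Lemma num_points_grid i L : (L <= N)%N ->
  num_points i (grid L) w = size (marks_at i (pmap id (take L c))).
Proof.
elim: L => [_|L IH LN].
  by rewrite take0 /grid mul0r (poisson_start (num_points_poisson M i)).
have := increments_match i LN; have {}IH := IH (ltnW LN).
have := poisson_nondecreasing (num_points_poisson M i) w (grid_ge0 L)
  (grid_homo (leqnSn L)).
rewrite (take_nth None) ?size_c// !size_marks_at -cats1 count_cat/= addn0.
rewrite -size_marks_at -IH; lia.
Qed.

(** With one point per cell, the chronological order is the order of the cells and
    sorting meets no tie. The [k]-th mark read at a location is the [k]-th letter
    of the word at that location. *)
Lemma requests_of_code : (0 < N)%N -> requests t w = pmap id c.
Proof.
move=> N0.
(* [P] lists the points of the first [L] cells, as pairs location, rank. *)
have H L : (L <= N)%N -> exists P : seq ('I_n * nat),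
   [/\ sorted <%R [seq arrival w p.1 p.2 | p <- P],
      forall p, (p \in P) = (p.2 < num_points p.1 (grid L) w)%N,
      forall p, p \in P -> arrival w p.1 p.2 <= grid L &
      [seq (p.1, mark p.1 p.2 w) | p <- P] = pmap id (take L c)].
  elim: L => [_|L IH LN].
    exists [::]; split => //; last by rewrite take0.
    move=> p; rewrite /grid mul0r (poisson_start (num_points_poisson M _)).
    by rewrite ltn0.
  have [P [P1 P2 P3 P4]] := IH (ltnW LN).
  have NL i : num_points i (grid L.+1) w =
      (num_points i (grid L) w + at_loc i (nth None c L))%N.
    have := poisson_nondecreasing (num_points_poisson M i) w (grid_ge0 L)
      (grid_homo (leqnSn L)).
    by have := increments_match i LN; lia.
  rewrite (take_nth None) ?size_c//.
  have tk : c = rcons (take L c) (nth None c L) ++ drop L.+1 c.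
    by rewrite -take_nth ?size_c// cat_take_drop.
  case: (nth None c L) NL tk => [[i b]|] NL tk; last first.
    exists P; split => //.
    - by move=> p; rewrite NL/= addn0.
    - by move=> p /P3 /le_trans; apply; exact: grid_homo.
    - by rewrite P4 -cats1 pmap_cat/= cats0.
  set k := num_points i (grid L) w.
  have kS : (k < num_points i (grid L.+1) w)%N by rewrite NL/= eqxx addn1.
  have arrk : grid L < arrival w i k.
    by apply: arrival_gt kS; rewrite ?grid_ge0.
  exists (rcons P (i, k)); split.
  - rewrite map_rcons/=; case/lastP: P P1 P3 {P2 P4} => [//|P q] P1 P3.
    rewrite !map_rcons in P1 *; rewrite -cats1.
    have qlt : arrival w q.1 q.2 < arrival w i k.
      by rewrite (le_lt_trans _ arrk)// P3// mem_rcons mem_head.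
    case: (map _ P) P1 => [|x s] /=; first by rewrite qlt.
    by move=> P1; rewrite cat_path P1 last_rcons/= qlt.
  - move=> [j k']; rewrite mem_rcons inE P2/= NL/= xpair_eqE.
    case: (eqVneq j i) => ji; last by rewrite addn0.
    by rewrite ji /= addn1 ltnS [RHS]leq_eqVlt.
  - move=> p; rewrite mem_rcons inE => /predU1P[->|/P3 /le_trans]/=.
      by apply: arrival_le kS; exact: grid_ge0.
    by apply; exact: grid_homo.
  - rewrite map_rcons P4 -!cats1 pmap_cat/=; congr (_ ++ [:: (_, _)]).
    have mE : marks_at i (pmap id c) =
        marks_at i (pmap id (take L c)) ++ b :: marks_at i (pmap id (drop L.+1 c)).
      rewrite {1}tk -cats1 !pmap_cat /marks_at !filter_cat !map_cat/=.
      by rewrite eqxx /= -catA.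
    have kE : k = size (marks_at i (pmap id (take L c))).
      by rewrite /k num_points_grid// ltnW.
    rewrite marks_match mE.
      by rewrite nth_cat kE ltnn subnn.
    by rewrite size_cat kE /= addnS ltnS leq_addr.
have [P [P1 P2 P3 P4]] := H N (leqnn N).
have gN : grid N = t by rewrite /grid mulrC divfK// pnatr_eq0 -lt0n.
rewrite -[in RHS](take_size c) size_c -P4 /requests; congr map.
have uP : uniq P by apply: map_uniq (lt_sorted_uniq P1).
set Q := (X in sort _ X).
have PQ : perm_eq (sort (fun p q => arrival w p.1 p.2 <= arrival w q.1 q.2) Q) P.
  rewrite perm_sort; apply: uniq_perm => //.
    apply: allpairs_uniq_dep; first exact: enum_uniq.
      by move=> i _; exact: iota_uniq.
    by move=> [i k] [j l] /= _ _ [-> ->].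
  move=> [i k]; rewrite P2 gN; apply/allpairsPdep/idP => /=.
    by move=> [j [l [_ + [-> ->]]]]; rewrite mem_iota.
  by move=> kN; exists i, k; rewrite mem_enum mem_iota.
apply: (@sorted_eq_in _ (fun p q => arrival w p.1 p.2 <= arrival w q.1 q.2) _ _ _ _ _ _ PQ).
- by move=> ? ? ? _ _ _ /=; exact: le_trans.
- move=> p q pP qP /= /le_anti; rewrite (perm_mem PQ) in pP.
  rewrite (perm_mem PQ) in qP => pq.
  exact: uniq_map_inj (lt_sorted_uniq P1) _ _ pP qP pq.
- by apply: sort_sorted => p q; exact: le_total.
- by move: P1; rewrite sorted_map; apply: sub_sorted => p q /ltW.
Qed.

End paths.

(** * The probability of a word of requests *)

Section code_probability.
Variables (R : realType) (n : nat) (lambda : R) (f : nat -> R).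
Variable M : request_model n lambda f.
Hypothesis lambda0 : 0 < lambda.
Variables (t : R) (N : nat).
Hypotheses (t0 : 0 < t) (N0 : (0 < N)%N).
Let grid (l : nat) : R := l%:R * (t / N%:R).
Let x := lambda * (t / N%:R).
Implicit Types (c : seq (option ('I_n * nat))) (i : 'I_n).

Definition increment i l (w : sample M) :=
  (num_points i (grid l.+1) w - num_points i (grid l) w)%N.

Definition code_event c : set (sample M) :=
  [set w | (forall i l, (l < N)%N -> increment i l w = at_loc i (nth None c l)) /\
           (forall i k, (k < size (marks_at i (pmap id c)))%N ->
             mark i k w = nth 0%N (marks_at i (pmap id c)) k)].

Definition code_weight (o : option ('I_n * nat)) : R :=
  expR (- (x * n%:R)) * (if o is Some y then x * f y.2 else 1).

Let x0 : 0 < x. Proof. by rewrite mulr_gt0// divr_gt0// ltr0n. Qed.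
Let grid0 l : 0 <= grid l. Proof. by rewrite mulr_ge0// divr_ge0// ltW. Qed.
Let gridS l : grid l < grid l.+1.
Proof. by rewrite /grid ltr_pM2r ?ltr_nat// divr_gt0// ltr0n. Qed.

Lemma increment_law i l (b : bool) :
  prob M [set w | increment i l w = b] = (expR (- x) * (if b then x else 1))%:E.
Proof.
rewrite (poisson_increment_law (num_points_poisson M i) _ (grid0 l) (gridS l)).
have -> : lambda * (grid l.+1 - grid l) = x.
  by rewrite /grid -mulrBl -natr1 addrAC subrr add0r mul1r.
rewrite /poisson_pmf x0; congr (_ %:E).
have -> : (nat_of_bool b)`! = 1%N by case: b.
by rewrite divr1 mulrC; case: b; rewrite /= ?expr1 ?expr0.
Qed.

Lemma process_system_increments i c : process_system (num_points i)
  [set w : sample M | forall l, (l < N)%N -> increment i l w = at_loc i (nth None c l)].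
Proof.
rewrite /process_system; set G := \bigcup_(u in _) _.
rewrite -[<<s _ >> _]/(@measurable _ (g_sigma_algebraType G) _).
have mN u Y : 0 <= u ->
    @measurable _ (g_sigma_algebraType G) [set w | num_points i u w = Y].
  move=> u0; apply: sub_sigma_algebra; exists u => //; exists [set Y] => //.
  by rewrite setTI.
have -> : [set w | forall l, (l < N)%N -> increment i l w = at_loc i (nth None c l)]
  = \bigcap_(l in [set l | (l < N)%N]) [set w | increment i l w = at_loc i (nth None c l)].
  by apply/seteqP; split => w /= H l; exact: H.
apply: bigcap_measurable => [|l _]; first by exists 0%N.
rewrite (_ : [set w | _] = \bigcup_a \bigcup_(b in [set b | (b - a)%N = at_loc i (nth None c l)])
   ([set w | num_points i (grid l.+1) w = b] `&` [set w | num_points i (grid l) w = a])).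
  apply: bigcup_measurable => a _; apply: bigcup_measurable => b _.
  by apply: measurableI; exact: mN.
apply/seteqP; split => w /=.
  by move=> H; exists (num_points i (grid l) w) => //; exists (num_points i (grid l.+1) w).
by move=> [a _ [b /= ba [wb wa]]]; rewrite /increment wb wa.
Qed.

Lemma increments_law i c : size c = N ->
  fine (prob M [set w | forall l, (l < N)%N -> increment i l w = at_loc i (nth None c l)])
  = \prod_(o <- c) (expR (- x) * (if at_loc i o then x else 1)).
Proof.
move=> cN; have := @poisson_increment_independent _ _ _ _ _ _ (num_points_poisson M i)
  grid (grid0 0) (fun l => ltW (gridS l)) (iota 0 N)
  (fun l => [set w | increment i l w = at_loc i (nth None c l)]) (iota_uniq _ _).
have -> : \bigcap_(l in [set` iota 0 N]) [set w : sample M | increment i l w = at_loc i (nth None c l)]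
  = [set w | forall l, (l < N)%N -> increment i l w = at_loc i (nth None c l)].
  by apply/seteqP; split => w /= H l; have := H l; rewrite /= mem_iota.
move=> ->; last first.
  by move=> l _; exists [set (at_loc i (nth None c l) : nat)] => //; rewrite setTI.
rewrite (big_nth None) cN /index_iota subn0; apply: eq_bigr => l _.
by rewrite increment_law.
Qed.

(** Independence gives a product over locations of products over cells, times a
    product over the marks; regrouping it cell by cell gives one weight per
    letter. *)
Lemma code_event_prob c : size c = N ->
  measurable (code_event c) /\
  prob M (code_event c) = (\prod_(o <- c) code_weight o)%:E.
Proof.
move=> cN.
pose A (y : 'I_n + 'I_n * nat) : set (sample M) := match y with
  | inl i => [set w | forall l, (l < N)%N -> increment i l w = at_loc i (nth None c l)]
  | inr (i, k) => [set w | mark i k w = nth 0%N (marks_at i (pmap id c)) k]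
  end.
pose s1 : seq ('I_n + 'I_n * nat) := [seq inl i | i <- enum 'I_n].
pose s2 : seq ('I_n + 'I_n * nat) := [seq inr (i, k) | i <- enum 'I_n,
   k <- iota 0 (size (marks_at i (pmap id c)))].
have EA : code_event c = \bigcap_(y in [set` s1 ++ s2]) A y.
  apply/seteqP; split => w.
    move=> [H1 H2] y; rewrite /= mem_cat => /orP[/mapP[i _ ->]|].
      by move=> l; exact: H1.
    move=> /allpairsPdep[i [k [_ + ->]]]; rewrite mem_iota => /andP[_].
    exact: H2.
  move=> H; split => [i l lN|i k ki].
    apply: (H (inl i)) => //=; rewrite mem_cat map_f//.
    by rewrite mem_enum.
  apply: (H (inr (i, k))) => /=; rewrite mem_cat; apply/orP; right.
  by apply/allpairsPdep; exists i, k; rewrite mem_enum mem_iota.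
have sysA y : match y with
         | inl i => process_system (num_points i)
         | inr (i, k) => rv_system (@mark _ _ _ _ M i k)
         end (A y).
  case: y => [i|[i k]]; first exact: process_system_increments.
  by exists [set nth 0%N (marks_at i (pmap id c)) k] => //; rewrite setTI.
have us : uniq (s1 ++ s2).
  rewrite cat_uniq; apply/and3P; split.
  - by rewrite map_inj_uniq ?enum_uniq// => i j [].
  - by apply/hasPn => y /allpairsPdep[i [k [_ _ ->]]]; apply/mapP => -[].
  - apply: allpairs_uniq_dep; first exact: enum_uniq.
      by move=> i _; exact: iota_uniq.
    by move=> [i k] [j l] /= _ _ [-> ->].
split.
  rewrite EA; apply: fin_bigcap_measurable => [|y _]; first exact: finite_seq.
  case: y (sysA y) => [i|[i k]]; last first.
    move=> _; rewrite -[A _]setTI; exact: (@mark_measurable _ _ _ _ M i k measurableT [set _]).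
  apply: smallest_sub; first exact: sigma_algebra_measurable.
  move=> B [u /= u0 [Y mY <-]]; exact: (poisson_measurable (num_points_poisson M i)).
rewrite EA (request_independent us (fun y _ => sysA y)); congr (_ %:E).
rewrite big_cat/= big_map big_allpairs_dep/=.
under eq_bigr do rewrite increments_law//.
rewrite exchange_big/= [X in _ * X](_ : _ =
   \prod_(o <- c) if o is Some y then f y.2 else 1); last first.
  transitivity (\prod_(i <- enum 'I_n) \prod_(y <- pmap id c | y.1 == i) f y.2).
    apply: eq_bigr => i _; have -> : \prod_(y <- pmap id c | y.1 == i) f y.2 =
        \prod_(b <- marks_at i (pmap id c)) f b.
      by rewrite /marks_at big_map big_filter.
    rewrite [RHS](big_nth 0%N) /index_iota subn0.
    by apply: eq_bigr => k _; rewrite mark_law.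
  rewrite big_enum/= (exchange_big_dep xpredT)//=.
  transitivity (\prod_(y <- pmap id c) f y.2).
    apply: eq_bigr => y _; rewrite (big_pred1 y.1)// => i; exact: eq_sym.
  elim: c {cN A s1 s2 EA sysA us} => [|[y|] c IH] /=; rewrite ?big_nil ?big_cons//.
    by rewrite IH.
  by rewrite mul1r IH.
rewrite -big_split/=; apply: eq_bigr => o _.
rewrite big_split/= /code_weight !big_enum/= prodr_const card_ord.
rewrite -expRM_natr mulNr -mulrA; congr (_ * _).
case: o => [y|]; last by rewrite big1 ?mulr1// => i _.
rewrite -big_mkcond/= (big_pred1 y.1)// => i; exact: eq_sym.
Qed.

End code_probability.

(** * Expectations known on disjoint events *)

Section partition_expectation.
Local Open Scope ereal_scope.
Context d (T : measurableType d) (R : realType) (P : probability T R).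

(** Monotonicity read on the definition as a supremum over simple functions, which
    also covers functions that have not been shown to be measurable. *)
Lemma ge0_le_integralT (f1 f2 : T -> \bar R) : (forall x, 0 <= f1 x) ->
  (forall x, f1 x <= f2 x) -> \int[P]_x f1 x <= \int[P]_x f2 x.
Proof.
move=> f10 f12; rewrite !ge0_integralTE// => [|x]; last exact: le_trans (f12 x).
apply: le_ereal_sup => _ [h hf1 <-]; exists h => // x.
exact: le_trans (f12 x).
Qed.

Lemma integral_sum_indic (I : finType) (E : I -> set T) (a : I -> R) :
  (forall i, measurable (E i)) -> (forall i, 0 <= a i)%R ->
  \int[P]_x (\sum_i a i * \1_(E i) x)%R%:E = (\sum_i a i * fine (P (E i)))%R%:E.
Proof.
move=> mE a0; under eq_integral do rewrite -sumEFin.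
rewrite ge0_integral_sum//=; last 2 first.
- move=> i; apply/measurable_EFinP; apply: measurable_funM => //.
- by move=> i x _; rewrite lee_fin mulr_ge0.
rewrite -sumEFin; apply: eq_bigr => i _.
under eq_integral do rewrite EFinM.
rewrite ge0_integralZl_EFin//; last by apply/measurable_EFinP.
by rewrite integral_indic// setIT EFinM fineK// fin_num_measure.
Qed.

(** The number of packages picked up is described on the events [E i] only. Being
    bounded, it lies between two step functions which differ by [C] outside
    these events. *)
Lemma expectation_on_cells (I : finType) (E : I -> set T) (g : I -> R)
    (X : T -> R) (C : R) :
  (forall i, measurable (E i)) ->
  (forall i j w, E i w -> E j w -> i = j) ->
  (forall w, 0 <= X w <= C)%R -> (forall i w, E i w -> X w = g i) ->
  (forall i, 0 <= g i)%R ->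
  (`|fine ('E_P[X]) - \sum_i g i * fine (P (E i))|
     <= C * (1 - \sum_i fine (P (E i))))%R.
Proof.
move=> mE dE XC Xg g0.
(* [None] stands for the complement of the cells. *)
pose E' (o : option I) := if o is Some i then E i else ~` \bigcup_(i in setT) E i.
have mE' o : measurable (E' o).
  case: o => [i|] //=; apply: measurableC.
  by apply: fin_bigcup_measurable => //; exact: finite_finset.
have sumE (a : option I -> R) w : exists o, E' o w /\
    (\sum_o a o * \1_(E' o) w)%R = a o.
  have [[i Ei]|nE] := pselect (exists i, E i w).
    exists (Some i); split => //; rewrite (bigD1 (Some i))//= big1 ?addr0.
      by rewrite indicE mem_set// mulr1.
    move=> [j|] ji; rewrite indicE memNset ?mulr0//=.
      by move=> Ej; move/eqP: ji; apply; rewrite (dE _ _ _ Ei Ej).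
    by apply; exists i.
  exists None; split.
    by move=> [i _ Ei]; apply: nE; exists i.
  rewrite (bigD1 None)//= big1 ?addr0.
    by rewrite indicE mem_set ?mulr1// => -[i _ Ei]; apply: nE; exists i.
  move=> [j|] ji //; rewrite indicE memNset ?mulr0//=.
  by move=> Ej; apply: nE; exists j.
have optE (F : option I -> R) : (\sum_o F o = F None + \sum_i F (Some i))%R.
  rewrite (bigD1 None)//=; congr +%R.
  rewrite (reindex_omap Some id)//= => [|[]//].
  by apply: eq_bigl => i; rewrite eqxx.
have Eone : (\sum_i fine (P (E i)) + fine (P (E' None)) = 1)%R.
  have := integral_sum_indic mE' (a := fun=> 1%R) (fun=> ler01).
  rewrite (_ : (fun w => _) = cst 1); last first.
    by apply/funext => w; have [q [_ ->]] := sumE (fun=> 1%R) w.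
  have P1 : P [set: T] = 1 by exact: probability_setT.
  rewrite integral_cst// [X in X = _](_ : _ = 1); last first.
    by rewrite mul1e; exact: P1.
  move=> /eqP; rewrite eqe => /eqP.
  by rewrite optE addrC mul1r; under eq_bigr do rewrite mul1r.
have C0 : (0 <= C)%R.
  have [q _] := sumE (fun=> 1%R) point.
  by have /andP[] := XC point; exact: le_trans.
have Xge : ((\sum_i g i * fine (P (E i)))%R%:E <= 'E_P[X]).
  pose a (o : option I) := if o is Some i then g i else 0%R.
  have -> : (\sum_i g i * fine (P (E i)) = \sum_q a q * fine (P (E' q)))%R.
    by rewrite optE mul0r add0r.
  have a0 q : (0 <= a q)%R by case: q.
  rewrite expectation.unlock; apply: (@le_trans _ _ (\int[P]_x (\sum_q a q * \1_(E' q) x)%R%:E)).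
    by rewrite le_eqVlt; apply/orP; left; apply/eqP/esym; exact: integral_sum_indic.
  apply: ge0_le_integralT => w.
    by rewrite lee_fin sumr_ge0// => -[i|] _; rewrite /= ?mul0r// mulr_ge0.
  rewrite lee_fin; have [[i|] [Ei ->]] := sumE a w; first by rewrite (Xg _ _ Ei).
  by have /andP[] := XC w.
have Xle : ('E_P[X] <= (C * fine (P (E' None)) + \sum_i g i * fine (P (E i)))%R%:E).
  pose a (o : option I) := if o is Some i then g i else C.
  have -> : (C * fine (P (E' None)) + \sum_i g i * fine (P (E i)) =
      \sum_q a q * fine (P (E' q)))%R by rewrite optE.
  have a0 q : (0 <= a q)%R by case: q.
  rewrite expectation.unlock; apply: (@le_trans _ _ (\int[P]_x (\sum_q a q * \1_(E' q) x)%R%:E)); last first.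
    by rewrite le_eqVlt; apply/orP; left; apply/eqP; exact: integral_sum_indic.
  apply: ge0_le_integralT => w; first by rewrite lee_fin; have /andP[] := XC w.
  rewrite lee_fin; have [[i|] [Ei ->]] := sumE a w; first by rewrite (Xg _ _ Ei).
  by have /andP[] := XC w.
have fE : 'E_P[X] \is a fin_num.
  by rewrite fin_numElt (lt_le_trans _ Xge) ?ltNyr// (le_lt_trans Xle) ?ltry.
have -> : (1 - \sum_i fine (P (E i)) = fine (P (E' None)))%R.
  by rewrite -Eone addrC addKr.
move: Xge Xle; rewrite -(fineK fE) !lee_fin => Xge Xle.
by rewrite ger0_norm ?subr_ge0// lerBlDr.
Qed.
End partition_expectation.

(** * The expected number of packages picked up *)

Section packing_semigroup.
Variables (R : realType) (m n : nat) (f : nat -> R) (lambda : R).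
Hypotheses (hf : is_bundle_pmf m f) (lambda0 : 0 < lambda).
Variables (fits : 'I_n -> nat -> bool) (bundle : 'I_n -> nat -> {set 'I_n}).

(** Sizes start at [1]: the letter [(i, b)] is a request of size [b.+1] at [i]. *)
Definition req_rate (y : 'I_n * 'I_m) : R := lambda * f y.2.+1.
Definition req_act (A : {set 'I_n}) (y : 'I_n * 'I_m) : {set 'I_n} :=
  serve fits bundle A (y.1, y.2.+1).
Definition remaining_mean : R -> {set 'I_n} -> R :=
  semigroup req_rate req_act (fun A => #|A|%:R).

Lemma req_rate_ge0 y : 0 <= req_rate y.
Proof. by case: hf => f0 _ _; rewrite mulr_ge0// ltW. Qed.

Lemma sum_pmf_ord : \sum_(b < m) f b.+1 = 1.
Proof. by case: hf => _ _; rewrite big_add1 big_mkord. Qed.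

Lemma total_req_rate : total_rate req_rate = lambda * n%:R.
Proof.
rewrite /total_rate /req_rate -(pair_bigA _ (fun _ (b : 'I_m) => lambda * f b.+1))/=.
under eq_bigr do rewrite -mulr_sumr sum_pmf_ord mulr1.
by rewrite sumr_const card_ord mulr_natr.
Qed.

Lemma card_sup_bounded : sup_bounded (fun A : {set 'I_n} => #|A|%:R : R) n%:R.
Proof.
move=> A; rewrite ger0_norm// ler_nat -[leqRHS](card_ord n).
exact: max_card.
Qed.

Variable M : request_model n lambda f.

Definition to_request (q : option ('I_n * 'I_m)) : option ('I_n * nat) :=
  omap (fun y : 'I_n * 'I_m => (y.1, y.2.+1)) q.

Lemma to_request_inj : injective to_request.
Proof.
move=> [[i b]|] [[j b']|]//= [-> bb']; congr (Some (_, _)); exact/val_inj.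
Qed.

Lemma foldl_step A (c : seq (option ('I_n * 'I_m))) :
  foldl (step req_act) A c =
  foldl (serve fits bundle) A (pmap id (map to_request c)).
Proof. by elim: c A => [//|[y|] c IH] A /=; rewrite IH. Qed.

Section positive_time.
Variables (t : R) (N : nat).
Hypotheses (t0 : 0 < t) (N0 : (0 < N)%N).

Lemma code_event_requests (c : seq (option ('I_n * nat))) w : size c = N ->
  code_event (M := M) t N c w -> requests t w = pmap id c.
Proof.
move=> cN [H1 H2]; apply: (@requests_of_code _ _ _ _ _ w t N) => //.
exact: ltW.
Qed.

(** The increments tell which letters are [None], and the list of requests gives
    the others. *)
Lemma code_event_disjoint (c c' : seq (option ('I_n * nat))) w :
  size c = N -> size c' = N ->
  code_event (M := M) t N c w -> code_event (M := M) t N c' w -> c = c'.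
Proof.
move=> cN cN' cw cw'.
have pE : pmap id c = pmap id c'.
  by rewrite -(code_event_requests cN cw) (code_event_requests cN' cw').
have locE l i : (l < N)%N -> at_loc i (nth None c l) = at_loc i (nth None c' l).
  move=> lN; have := cw.1 i l lN; rewrite (cw'.1 i l lN).
  by case: at_loc; case: at_loc.
have {locE} isE l : isSome (nth None c l) = isSome (nth None c' l).
  have [lN|lN] := ltnP l N; last by rewrite !nth_default ?cN ?cN'.
  case E : (nth None c l) => [y|]; case E' : (nth None c' l) => [y'|]//.
    by have := locE l y.1 lN; rewrite E E'/= eqxx.
  by have := locE l y'.1 lN; rewrite E E'/= eqxx.
move: cN' pE isE; rewrite -cN; elim: c c' {cw cw' cN} => [|a c IH] [|a' c']//.
move=> /= [cs] pE isE; have := isE 0%N.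
case: a a' pE {isE} (fun l => isE l.+1) => [y|] [y'|]//= pE isE _.
  by case: pE => -> /IH ->.
by rewrite (IH _ cs pE isE).
Qed.

(** The words miss only the samples having two requests in some cell. *)
Lemma picked_up_error :
  `|expected_picked_up M fits bundle t -
     iter N (euler req_rate req_act (t / N%:R)) (fun A => #|(~: A)%SET|%:R) [set: 'I_n]%SET|
  <= n%:R * (1 - iter N (euler req_rate req_act (t / N%:R)) (fun=> 1) [set: 'I_n]%SET).
Proof.
pose E (c : N.-tuple (option ('I_n * 'I_m))) := code_event (M := M) t N (map to_request c).
pose g (c : N.-tuple (option ('I_n * 'I_m))) : R :=
  #|(~: foldl (step req_act) [set: 'I_n] c)%SET|%:R.
have sz (c : N.-tuple (option ('I_n * 'I_m))) : size (map to_request c) = N.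
  by rewrite size_map size_tuple.
have PE c : fine (prob M (E c)) = \prod_(o <- c) step_weight req_rate (t / N%:R) o.
  rewrite (code_event_prob M lambda0 t0 N0 (sz c)).2 /= big_map.
  apply: eq_bigr => q _; rewrite /code_weight /step_weight total_req_rate.
  rewrite mulrAC; case: q => [y|]//=.
  by rewrite /req_rate mulrAC [lambda * _]mulrC mulrAC !mulrA.
rewrite !iter_euler_words.
under eq_bigr do rewrite mulrC -PE.
under [X in _ <= _ * (1 - X)]eq_bigr do rewrite mulr1 -PE.
apply: (@expectation_on_cells _ _ _ _ _ E g).
- by move=> c; have [] := code_event_prob M lambda0 t0 N0 (sz c).
- move=> c c' w cw cw'; apply/val_inj.
  exact/(inj_map to_request_inj)/(code_event_disjoint (sz c) (sz c') cw cw').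
- by move=> w; rewrite ler0n ler_nat /picked_up -[leqRHS](card_ord n) max_card.
- move=> c w cw; rewrite /g foldl_step /picked_up.
  by rewrite (code_event_requests (sz c) cw).
- by move=> c; exact: ler0n.
Qed.

End positive_time.

(** As the cells shrink, the words exhaust the probability space while the Euler
    iterates converge. *)
Lemma expected_picked_upE t : 0 <= t ->
  expected_picked_up M fits bundle t = n%:R - remaining_mean t [set: 'I_n]%SET.
Proof.
rewrite le_eqVlt => /predU1P[<-|t0].
  rewrite /remaining_mean semigroup0.
  rewrite cardsT card_ord subrr /expected_picked_up.
  rewrite (_ : (fun w => _) = cst 0); last first.
    apply/funext => w; rewrite /picked_up /requests /=.
    set s := [seq (_, _) | _ <- _, _ <- _].
    have -> : s = [::].
      rewrite /s; elim: (enum _) => //= i e ->.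
      by rewrite (poisson_start (num_points_poisson M i)).
    by rewrite /= finset.setCT cards0.
  by rewrite expectation_cst.
have ubC : sup_bounded (fun A : {set 'I_n} => #|(~: A)%SET|%:R : R) n%:R.
  by move=> A; exact: card_sup_bounded.
have ub1 : sup_bounded (fun A : {set 'I_n} => 1 : R) 1.
  by move=> A; rewrite normr1.
have -> : n%:R - remaining_mean t [set: 'I_n]%SET =
    semigroup req_rate req_act (fun A => #|(~: A)%SET|%:R) t [set: 'I_n]%SET.
  rewrite -(semigroup_cst_sub _ req_rate_ge0 _ _ _ card_sup_bounded).
  congr (semigroup _ _ _ t _); apply/funext => A.
  by have /(congr1 (fun k => k%:R : R)) := cardsC A; rewrite card_ord natrD => <-; rewrite addrC addKr.
have cu := cvg_iter_euler req_rate_ge0 (act := req_act) (s := [set: 'I_n]%SET) ubC (ltW t0).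
have c1 := cvg_iter_euler req_rate_ge0 (act := req_act) (s := [set: 'I_n]%SET) ub1 (ltW t0).
rewrite semigroup_cst in c1.
apply/eqP; rewrite -subr_eq0 -normr_le0.
set X := expected_picked_up _ _ _ _.
set u := (fun N : nat => _) in cu; set v := (fun N : nat => _) in c1.
have c2 : `|X - u N| @[N --> \oo] -->
    `|X - semigroup req_rate req_act (fun A => #|(~: A)%SET|%:R) t [set: 'I_n]%SET|.
  by apply: cvg_norm; apply: cvgB => //; exact: cvg_cst.
have c3 : n%:R * (1 - v N) @[N --> \oo] --> (n%:R * (1 - 1) : R).
  by apply: cvgMl_tmp; apply: cvgB => //; exact: cvg_cst.
rewrite subrr mulr0 in c3.
by apply: (ler_cvg_to c2 c3); apply: nearW => N; exact: picked_up_error.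
Qed.

End packing_semigroup.

(** * Splitting into gaps *)

Section gap_coefficients.

Variables (R : realType) (m : nat) (f : nat -> R) (lambda : R).

(** The value of [G^N] applied to the cardinal, at an interval of [l] packages: an
    accepted request of size [b.+1] with [j] packages before it leaves the two
    intervals of lengths [j] and [l - b.+1 - j]. *)
Fixpoint gap_coef (N l : nat) : R :=
  if N is N'.+1 then
    lambda * \sum_(b < m) f b.+1 * \sum_(j < l - b)
      (gap_coef N' j + gap_coef N' (l - b.+1 - j) - gap_coef N' l)
  else l%:R.

Definition gap_mean (t : R) (l : nat) : R := egf (gap_coef ^~ l) t.

Section charts.
Variables (n : nat) (fits : 'I_n -> nat -> bool).
Variable bundle : 'I_n -> nat -> {set 'I_n}.
Implicit Types (A B : {set 'I_n}) (i : 'I_n).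

Local Notation G := (generator (req_rate f lambda) (@req_act m n fits bundle)).
Local Notation card_fun := (fun A : {set 'I_n} => #|A|%:R : R).

(** Packages of [A] and [B] are never requested together, as happens for intervals
    on both sides of a package that has been picked up. *)
Definition separated A B := [disjoint A & B]%B /\
  forall i b, fits i b.+1 -> bundle i b.+1 \subset (A :|: B)%SET ->
    (bundle i b.+1 \subset A) || (bundle i b.+1 \subset B).

Lemma separatedS A B A' B' : A' \subset A -> B' \subset B ->
  separated A B -> separated A' B'.
Proof.
move=> sA sB [dAB sep]; split.
  exact: fintype.disjointW sA sB dAB.
move=> i b fib bAB.
have bAB' : bundle i b.+1 \subset (A :|: B)%SET.
  by apply: (fintype.subset_trans bAB); exact: finset.setUSS.
move: (sep _ _ fib bAB') => /orP[bA|bB]; apply/orP; [left|right].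
  apply/fintype.subsetP => j jb; have := fintype.subsetP bAB _ jb; rewrite finset.in_setU => /orP[//|jB'].
  by have := fintype.disjointFr dAB (fintype.subsetP bA _ jb); rewrite (fintype.subsetP sB _ jB').
apply/fintype.subsetP => j jb; have := fintype.subsetP bAB _ jb; rewrite finset.in_setU => /orP[jA'|//].
by have := fintype.disjointFl dAB (fintype.subsetP bB _ jb); rewrite (fintype.subsetP sA _ jA').
Qed.

Lemma req_act_sub A (y : 'I_n * 'I_m) : req_act fits bundle A y \subset A.
Proof. by rewrite /req_act /serve; case: ifP => // _; exact: finset.subsetDl. Qed.

Lemma req_act_separated A B (y : 'I_n * 'I_m) : separated A B ->
  req_act fits bundle (A :|: B)%SET y =
  (req_act fits bundle A y :|: req_act fits bundle B y)%SET.
Proof.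
move=> [dAB sep]; rewrite /req_act /serve /=.
case: (boolP (fits y.1 y.2.+1)) => //= fy.
set b := bundle _ _ in sep *.
have H (C D : {set 'I_n}) : [disjoint C & D]%B -> b \subset C ->
   (if b \subset D then (D :\: b)%SET else D) = (D :\: b)%SET.
  move=> dCD bC; case: ifP => // _; apply/esym/finset.setDidPl.
  rewrite fintype.disjoint_sym; exact: fintype.disjointWl bC dCD.
case: ifP => bAB.
  have /orP[bA|bB] := sep _ _ fy bAB.
    by rewrite bA (H _ _ dAB bA) finset.setDUl.
  by rewrite bB (H B A _ bB) ?finset.setDUl// fintype.disjoint_sym.
case: ifP => bA; first by rewrite (fintype.subset_trans bA (finset.subsetUl _ _)) in bAB.
by case: ifP => // bB; rewrite (fintype.subset_trans bB (finset.subsetUr _ _)) in bAB.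
Qed.

(** Serving a request commutes with the union of separated sets, and the cardinal
    is additive. *)
Lemma iter_generator_separated N A B : separated A B ->
  iter N G card_fun (A :|: B)%SET = iter N G card_fun A + iter N G card_fun B.
Proof.
elim: N A B => [|N IH] A B sep.
  rewrite /= -natrD; congr _%:R; apply/eqP.
  by rewrite (leq_card_setU A B).2; case: sep.
rewrite !iterS /generator -big_split/=; apply: eq_bigr => y _.
rewrite req_act_separated// IH; last first.
  by apply: separatedS sep; exact: req_act_sub.
rewrite IH//; ring.
Qed.

Variables (p : nat -> 'I_n) (k0 : nat).
(** A chart [p] numbers [k0] packages so that the requests for them alone look as
    on a line. A line has one chart; on a circle, every arc other than the whole
    circle has one. *)
Definition chart_itv (x l : nat) : {set 'I_n} :=
  finset (fun i => i \in [seq p y | y <- iota x l]).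

Hypothesis p_inj : forall y z, (y < k0)%N -> (z < k0)%N -> p y = p z -> y = z.
Hypothesis chart_accept : forall i b, fits i b.+1 ->
  bundle i b.+1 \subset chart_itv 0 k0 -> exists2 j, (j + b.+1 <= k0)%N & i = p j.
Hypothesis chart_bundle : forall j b, (j + b.+1 <= k0)%N ->
  fits (p j) b.+1 /\ bundle (p j) b.+1 = chart_itv j b.+1.

Lemma in_chart_itv x l z : (x + l <= k0)%N -> (z < k0)%N ->
  (p z \in chart_itv x l) = (x <= z < x + l)%N.
Proof.
move=> xl zk; rewrite inE; apply/mapP/idP => [[y]|xz].
  by rewrite mem_iota => /andP[xy yl] /p_inj ->; rewrite ?xy//; lia.
by exists z; rewrite ?mem_iota.
Qed.

Lemma chart_itvP x l i : (x + l <= k0)%N ->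
  reflect (exists2 z, (x <= z < x + l)%N & i = p z) (i \in chart_itv x l).
Proof.
move=> xl; rewrite inE; apply: (iffP mapP) => -[z zx ->]; exists z => //.
  by move: zx; rewrite mem_iota.
by rewrite mem_iota.
Qed.

Lemma chart_itv_sub x l y k : (x + l <= k0)%N -> (y + k <= k0)%N -> (0 < l)%N ->
  (chart_itv x l \subset chart_itv y k) = ((y <= x) && (x + l <= y + k))%N.
Proof.
move=> xl yk l0; apply/fintype.subsetP/idP => [H|/andP[yx xlk] i /(chart_itvP _ xl)[z xz ->]].
  have /H : p x \in chart_itv x l by rewrite in_chart_itv; lia.
  have /H : p (x + l.-1)%N \in chart_itv x l by rewrite in_chart_itv; lia.
  by rewrite !in_chart_itv; lia.
by rewrite in_chart_itv; lia.
Qed.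

Lemma chart_serve x l j (b : 'I_m) : (x + l <= k0)%N -> (j + b.+1 <= l)%N ->
  req_act fits bundle (chart_itv x l) (p (x + j), b) =
  (chart_itv x j :|: chart_itv (x + j + b.+1) (l - b.+1 - j))%SET.
Proof.
move=> xl jb; rewrite /req_act /serve/=.
have xjb : (x + j + b.+1 <= k0)%N by lia.
have [-> ->] := chart_bundle xjb.
rewrite chart_itv_sub ?andTb; [|lia..].
rewrite ifT; last by lia.
apply/finset.setP => i; rewrite finset.in_setD finset.in_setU.
have [/(chart_itvP _ xl)[z xz ->]|iN] := boolP (i \in chart_itv x l).
  by rewrite !in_chart_itv; lia.
have H y k : (x <= y)%N -> (y + k <= x + l)%N -> (i \in chart_itv y k) = false.
  move=> xy yk; apply/negbTE; apply: contra iN => /chart_itvP[|z zy ->].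
    lia.
  by rewrite in_chart_itv; lia.
by rewrite andbF !H//; lia.
Qed.

(** [l - b] counts the positions at which a request of size [b.+1] fits. *)
Lemma chart_serve_no x l i (b : 'I_m) : (x + l <= k0)%N ->
  i \notin [seq p y | y <- iota x (l - b)] ->
  req_act fits bundle (chart_itv x l) (i, b) = chart_itv x l.
Proof.
move=> xl iN; rewrite /req_act /serve/=; case: ifP => // /andP[fib bsub].
have bsub0 : bundle i b.+1 \subset chart_itv 0 k0.
  apply: (fintype.subset_trans bsub); apply/fintype.subsetP => j /(chart_itvP _ xl)[z xz ->].
  by rewrite in_chart_itv; lia.
have [j jb iE] := chart_accept fib bsub0.
move: bsub; rewrite iE (chart_bundle jb).2 chart_itv_sub// => jx.
by case/negP: iN; rewrite iE map_f// mem_iota; lia.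
Qed.

Lemma chart_separated x l y k : (x + l < y)%N -> (y + k <= k0)%N ->
  separated (chart_itv x l) (chart_itv y k).
Proof.
move=> xly yk; split.
  rewrite -finset.setI_eq0; apply/eqP/finset.setP => i; rewrite finset.in_setI finset.in_set0.
  apply/negbTE/andP => -[/chart_itvP[|z zx ->]]; first lia.
  by rewrite in_chart_itv; lia.
move=> i b fib bsub.
have bsub0 : bundle i b.+1 \subset chart_itv 0 k0.
  apply: (fintype.subset_trans bsub); apply/fintype.subsetP => j; rewrite finset.in_setU => /orP[].
    by move=> /chart_itvP[|z zx ->]; rewrite ?in_chart_itv; lia.
  by move=> /chart_itvP[|z zx ->]; rewrite ?in_chart_itv; lia.
have [j jb iE] := chart_accept fib bsub0; move: bsub.
rewrite iE (chart_bundle jb).2 !chart_itv_sub//; [|lia..].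
move=> /fintype.subsetP H.
have H1 z : (j <= z < j + b.+1)%N -> (x <= z < x + l)%N || (y <= z < y + k)%N.
  move=> zj; have /H : p z \in chart_itv j b.+1 by rewrite in_chart_itv; lia.
  by rewrite finset.in_setU !in_chart_itv; lia.
have := H1 j; have := H1 (j + b)%N; have := H1 (x + l)%N; lia.
Qed.

(** The generator only sees the requests accepted inside the interval; each
    splits it into two separated intervals. *)
Lemma iter_generator_chart N x l : (x + l <= k0)%N ->
  iter N G card_fun (chart_itv x l) = gap_coef N l.
Proof.
elim: N x l => [|N IH] x l xl.
  rewrite /= /chart_itv cardsE (card_uniqP _) ?size_map ?size_iota//.
  rewrite map_inj_in_uniq ?iota_uniq// => y z; rewrite !mem_iota => yx zx.
  by apply: p_inj; lia.
rewrite iterS /generator /= mulr_sumr.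
rewrite -(pair_bigA _ (fun i (b : 'I_m) => req_rate f lambda (i, b) *
  (iter N G card_fun (req_act fits bundle (chart_itv x l) (i, b)) -
   iter N G card_fun (chart_itv x l))))/= exchange_big/=.
apply: eq_bigr => b _; rewrite /req_rate/= -mulr_sumr mulrA; congr (_ * _).
rewrite (bigID (mem [seq p y | y <- iota x (l - b)]))/= addrC big1 ?add0r; last first.
  by move=> i iN; rewrite chart_serve_no// subrr.
have u : uniq [seq p y | y <- iota x (l - b)].
  rewrite map_inj_in_uniq ?iota_uniq// => y z; rewrite !mem_iota => yx zx.
  by apply: p_inj; lia.
rewrite -(big_uniq _ u)/= big_map -[X in iota X]addn0 iotaDl big_map.
have -> : iota 0 (l - b) = index_iota 0 (l - b) by rewrite /index_iota subn0.
rewrite big_mkord; apply: eq_bigr => j _.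
have jl := ltn_ord j.
rewrite chart_serve ?iter_generator_separated; [|try lia..]; last first.
  by apply: chart_separated; lia.
by rewrite !IH//; lia.
Qed.

End charts.
End gap_coefficients.

(** * Mean number of packages left on a line and on a circle *)

Section gap_dynamics.
Variables (R : realType) (m : nat) (f : nat -> R) (lambda : R).
Hypotheses (hf : is_bundle_pmf m f) (lambda0 : 0 < lambda).

Local Notation gap_coef := (gap_coef m f lambda).
Local Notation gap_mean := (gap_mean m f lambda).
Local Notation lineG n := (generator (req_rate f lambda)
  (@req_act m n (@line_fits n) (@line_bundle n))).
Local Notation card_fun n := (fun A : {set 'I_n} => #|A|%:R : R).

Lemma iter_generator_line N n :
  iter N (lineG n) (card_fun n) [set: 'I_n]%SET = gap_coef N n.
Proof.
case: n => [|n].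
  elim: N => [|N IH] /=; first by rewrite cardsT card_ord.
  rewrite /generator [LHS]big1 => [|[[]]//].
  by rewrite big1 ?mulr0// => b _; rewrite big_ord0 mulr0.
have -> : [set: 'I_n.+1]%SET = chart_itv (fun y => inord y : 'I_n.+1) 0 n.+1.
  apply/finset.setP => i; rewrite finset.in_setT finset.in_set; apply/esym/mapP.
  by exists (val i); rewrite ?mem_iota ?inord_val//=.
apply: (@iter_generator_chart R m f lambda _ _ _ _ n.+1) => //.
- by move=> y z yn zn /(congr1 val); rewrite /= !inordK.
- by move=> i b ib _; exists (val i); rewrite ?inord_val.
- move=> j b jb; have jn : (j < n.+1)%N by lia.
  rewrite /line_fits /line_bundle inordK//; split => //.
  apply/finset.setP => i; rewrite !finset.in_set; apply/idP/mapP => [ji|[y]].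
    by exists (val i); rewrite ?mem_iota ?inord_val.
  by rewrite mem_iota => jy ->; rewrite inordK//; lia.
Qed.

Lemma geom_gap_coef l : geom_bounded (gap_coef ^~ l).
Proof.
have := @geom_iter_generator _ _ _ _ (@req_act m l (@line_fits l) (@line_bundle l))
  (req_rate_ge0 hf lambda0) _ _ [set: 'I_l]%SET (@card_sup_bounded R l).
by congr geom_bounded; apply/funext => N; rewrite iter_generator_line.
Qed.

Lemma line_mean t n :
  remaining_mean m f lambda (@line_fits n) (@line_bundle n) t [set: 'I_n]%SET
  = gap_mean t n.
Proof.
by congr egf; apply/funext => N; exact: iter_generator_line.
Qed.

Definition gap_drift t l : R := lambda * \sum_(b < m) f b.+1 *
  \sum_(j < l - b) (gap_mean t j + gap_mean t (l - b.+1 - j) - gap_mean t l).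

Lemma is_derive_gap_mean t l :
  is_derive t (1 : R) (gap_mean ^~ l) (gap_drift t l).
Proof.
apply: is_derive_rewrite (is_derive_egf t (geom_gap_coef l)) _.
have g := geom_gap_coef; have gN l' : geom_bounded (fun N => -1 * gap_coef N l').
  exact: geom_boundedZ.
have gs b (j : 'I_(l - b)) : geom_bounded (fun N => gap_coef N j +
    gap_coef N (l - b.+1 - j) + -1 * gap_coef N l).
  by apply: geom_boundedD => //; exact: geom_boundedD.
transitivity (egf (fun N => lambda * \sum_(b < m) f b.+1 * \sum_(j < l - b)
   (gap_coef N j + gap_coef N (l - b.+1 - j) + -1 * gap_coef N l)) t).
  congr egf; apply/funext => N /=; congr (_ * _); apply: eq_bigr => b _.
  by congr (_ * _); apply: eq_bigr => j _; rewrite mulN1r.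
rewrite egfZ; last first.
  by apply: geom_bounded_sum => b _; apply: geom_boundedZ; exact: geom_bounded_sum.
rewrite egf_sum; last first.
  by move=> b _; apply: geom_boundedZ; exact: geom_bounded_sum.
congr (_ * _); apply: eq_bigr => b _; rewrite egfZ; last exact: geom_bounded_sum.
rewrite egf_sum//; congr (_ * _); apply: eq_bigr => j _.
by rewrite egfD ?egfD ?egfZ ?mulN1r//; exact: geom_boundedD.
Qed.

Lemma gap_mean_at0 l : gap_mean 0 l = l%:R.
Proof. exact: egf_at0. Qed.

Lemma gap_mean_bounded t l : 0 <= t -> `|gap_mean t l| <= l%:R.
Proof.
move=> t0; rewrite -line_mean /remaining_mean.
exact: (semigroup_bounded _ (req_rate_ge0 hf lambda0) (@card_sup_bounded R l) t0).
Qed.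

(** The drift is [e^(t G) (G #|.|)] at the full line, and [G #|.|] is small since an
    accepted request removes at most [m] packages. *)
Lemma gap_drift_bounded t l : 0 <= t -> `|gap_drift t l| <= lambda * l%:R * m%:R.
Proof.
move=> t0; have p0 := @req_rate_ge0 R m l _ _ hf lambda0.
have ub : sup_bounded (lineG l (card_fun l)) (lambda * l%:R * m%:R).
  move=> A; apply: (le_trans (ler_norm_sum _ _ _)).
  rewrite -(total_req_rate l lambda hf) /total_rate mulr_suml; apply: ler_sum => y _.
  rewrite normrM (ger0_norm (p0 y)) ler_wpM2l// /req_act /serve/=.
  case: ifP => _; last by rewrite subrr normr0.
  rewrite distrC ger0_norm; last first.
    by rewrite subr_ge0 ler_nat subset_leq_card// finset.subsetDl.
  rewrite lerBlDr -natrD ler_nat -(cardsID (line_bundle y.1 y.2.+1) A) leq_add2r.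
  apply: (leq_trans (subset_leq_card (finset.subsetIr _ _))).
  apply: (@leq_trans y.2.+1); last exact: ltn_ord.
  rewrite -[leqRHS](size_iota y.1) cardE -(size_map val).
  apply: uniq_leq_size; first by rewrite map_inj_uniq ?enum_uniq//; exact: val_inj.
  move=> j /mapP[i]; rewrite mem_enum /line_bundle finset.in_set => ij ->.
  by rewrite mem_iota.
suff -> : gap_drift t l =
    semigroup (req_rate f lambda) (@req_act m l (@line_fits l) (@line_bundle l))
      (lineG l (card_fun l)) t [set: 'I_l]%SET.
  exact: (semigroup_bounded _ p0 ub t0).
have D1 := is_derive_gap_mean t l.
have D2 := @is_derive_semigroup _ _ _ _ (@req_act m l (@line_fits l) (@line_bundle l))
  p0 _ _ t [set: 'I_l]%SET (@card_sup_bounded R l).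
rewrite (_ : gap_mean ^~ l = (semigroup (req_rate f lambda)
    (@req_act m l (@line_fits l) (@line_bundle l)) (card_fun l)) ^~ [set: 'I_l]%SET) in D1.
  by rewrite -(@derive_val _ _ _ _ _ _ _ D1) -(@derive_val _ _ _ _ _ _ _ D2).
by apply/funext => u; rewrite -line_mean.
Qed.

Section circle.
Variable n : nat.
Hypotheses (hm : (0 < m)%N) (mn : (m <= n.+1)%N).

Definition circle_mean t : R := remaining_mean m f lambda (@circle_fits n.+1)
  (@circle_bundle n.+1) t [set: 'I_n.+1]%SET.

Local Notation arc a := (chart_itv (fun y => inord ((a + y) %% n.+1) : 'I_n.+1)).
Local Notation circleG := (generator (req_rate f lambda)
  (@req_act m n.+1 (@circle_fits n.+1) (@circle_bundle n.+1))).

Lemma circle_bundleE (i : 'I_n.+1) k : circle_bundle i k = arc i 0 k.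
Proof.
apply/finset.setP => j; rewrite !finset.in_set; apply/existsP/mapP.
  move=> [l /eqP jl]; exists (val l); first by rewrite mem_iota /=.
  by apply/val_inj; rewrite /= inordK ?ltn_mod.
move=> [y]; rewrite mem_iota => /= yk ->; exists (Ordinal yk).
by rewrite /= inordK ?ltn_mod.
Qed.

Lemma arc_inj a k y z : (k <= n.+1)%N -> (y < k)%N -> (z < k)%N ->
  inord ((a + y) %% n.+1) = inord ((a + z) %% n.+1) :> 'I_n.+1 -> y = z.
Proof.
move=> kn yk zk /(congr1 val); rewrite /= !inordK ?ltn_mod// => /eqP.
by rewrite eqn_modDl !modn_small; lia || (by move/eqP).
Qed.

(** If a request accepted in the arc ran over its end, it would contain the first
    package after the arc, which exists as the arc is not the whole circle. *)
Lemma iter_generator_arc N a l : (l <= n)%N ->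
  iter N circleG (card_fun n.+1) (arc a 0 l) = gap_coef N l.
Proof.
move=> ln; apply: (@iter_generator_chart R m f lambda _ _ _ _ l) => //.
- by move=> y z yl zl; apply: (@arc_inj a l); lia.
- move=> i b fb; rewrite circle_bundleE => /fintype.subsetP bs.
  have mem k : (k < b.+1)%N -> exists2 j, (j < l)%N & ((i + k) %% n.+1 = (a + j) %% n.+1)%N.
    move=> kb; have : inord ((i + k) %% n.+1) \in arc i 0 b.+1.
      by rewrite finset.in_set; apply/mapP; exists k; rewrite ?mem_iota.
    move=> /bs; rewrite finset.in_set => /mapP[j]; rewrite mem_iota => jl /(congr1 val).
    by rewrite /= !inordK ?ltn_mod// => E; exists j.
  have [j jl] := mem 0%N isT; rewrite addn0 modn_small ?ltn_ord// => ij.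
  exists j; last by apply/val_inj; rewrite /= inordK ?ltn_mod.
  rewrite leqNgt; apply/negP => lt.
  have [|j' j'l] := mem (l - j)%N; first lia.
  rewrite ij modnDml -addnA subnKC ?(ltnW jl)// => /eqP.
  by rewrite eqn_modDl !modn_small; lia.
- move=> j b jb; split; first by rewrite /circle_fits; lia.
  rewrite circle_bundleE; apply/finset.setP => i; rewrite !finset.in_set.
  apply/mapP/mapP => -[y]; rewrite mem_iota => yb ->.
    exists (j + y)%N; first by rewrite mem_iota; lia.
    by apply/val_inj; rewrite /= !inordK ?ltn_mod// modnDml addnA.
  exists (y - j)%N; first by rewrite mem_iota; lia.
  apply/val_inj; rewrite /= !inordK ?ltn_mod// modnDml -addnA subnKC//; lia.
Qed.

(** From the full circle every request fits, and leaves an arc. *)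
Lemma is_derive_circle_mean t : is_derive t (1 : R) circle_mean
  (lambda * n.+1%:R * (\sum_(b < m) f b.+1 * gap_mean t (n - b) - circle_mean t)).
Proof.
have p0 := @req_rate_ge0 R m n.+1 _ _ hf lambda0.
have := @is_derive_semigroup _ _ _ _ (@req_act m n.+1 (@circle_fits n.+1)
  (@circle_bundle n.+1)) p0 _ _ t [set: 'I_n.+1]%SET (@card_sup_bounded R n.+1).
move=> /is_derive_rewrite; apply.
rewrite (semigroup_generator _ p0 _ _ (@card_sup_bounded R n.+1)) /generator.
transitivity (\sum_(i < n.+1) \sum_(b < m)
   lambda * (f b.+1 * (gap_mean t (n - b) - circle_mean t))).
  rewrite pair_bigA; apply: eq_bigr => -[i b] _ /=.
  rewrite /req_rate /= -mulrA; congr (_ * (_ * (_ - _))).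
  have bn : (b.+1 <= n.+1)%N by apply: leq_trans mn.
  rewrite /req_act /serve /= finset.subsetT /circle_fits bn/=.
  have -> : ([set: 'I_n.+1] :\: circle_bundle i b.+1)%SET = arc (i + b.+1)%N 0 (n - b).
    apply/finset.setP => j; rewrite finset.in_setD finset.in_setT andbT circle_bundleE.
    have [y yn ->] : exists2 y, (y < n.+1)%N & j = inord ((i + y) %% n.+1).
      exists ((j + (n.+1 - i)) %% n.+1)%N; first by rewrite ltn_mod.
      apply/val_inj; rewrite /= inordK ?ltn_mod// modnDmr addnCA subnKC; last first.
        by rewrite ltnW.
      by rewrite modnDr modn_small.
    have -> : arc (i + b.+1)%N 0 (n - b) = arc i b.+1 (n - b).
      rewrite /chart_itv; congr finset; apply/funext => z; congr (z \in _).
      rewrite -[in RHS](addn0 b.+1) iotaDl -map_comp.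
      by apply: eq_map => k /=; rewrite addnA.
    have inj := @arc_inj i n.+1 _ _ (leqnn _).
    by rewrite !(in_chart_itv inj) //; lia.
  by congr egf; apply/funext => N; rewrite iter_generator_arc// leq_subr.
rewrite sumr_const card_ord -mulr_sumr -mulr_natr.
under eq_bigr do rewrite mulrBr.
rewrite sumrB -mulr_suml (sum_pmf_ord hf); ring.
Qed.

Lemma circle_mean_at0 : circle_mean 0 = n.+1%:R.
Proof.
rewrite /circle_mean /remaining_mean.
by rewrite semigroup0 cardsT card_ord.
Qed.

End circle.
End gap_dynamics.

(** * Shifts, differences and tails *)

Section shifts.
Variable R : comNzRingType.
Implicit Types (a : nat -> R) (b n : nat).

(** Multiplication of the power series with coefficients [a] by [X ^ b] and by
    [1 - X]. *)
Definition nshift b a n : R := if (b <= n)%N then a (n - b)%N else 0.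
Definition bdiff a n : R := a n - nshift 1 a n.

Lemma shift_shift b c a n : nshift b (nshift c a) n = nshift (b + c) a n.
Proof.
rewrite /nshift; case: leqP => [bn|nb]; last by rewrite leqNgt ltn_addr.
by rewrite leq_subRL// subnDA.
Qed.

Lemma shift_bdiff b a n : nshift b (bdiff a) n = nshift b a n - nshift b.+1 a n.
Proof.
rewrite -addn1 -shift_shift /bdiff; move: (nshift 1 a) => a'.
by rewrite /nshift; case: (b <= n)%N; rewrite ?subr0.
Qed.

Lemma bdiff_prefix_sum b a n :
  bdiff (fun n => \sum_(j < n - b) a j) n = nshift b.+1 a n.
Proof.
rewrite /bdiff /nshift; case: n => [|n] /=; first by rewrite sub0n big_ord0 subr0.
rewrite subn1 subSS /=; have [bn|nb] := leqP b n.
  by rewrite ltnS bn subSn// big_ord_recr/= addrAC subrr add0r.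
rewrite ltnS leqNgt nb /=.
have /eqP -> : (n.+1 - b == 0)%N by rewrite subn_eq0.
have /eqP -> : (n - b == 0)%N by rewrite subn_eq0 ltnW.
by rewrite subrr.
Qed.

Lemma bdiff_mulnat a n :
  bdiff (fun n => n%:R * a n) n = n%:R * bdiff a n + nshift 1 a n.
Proof.
rewrite /bdiff /nshift; case: n => [|n] /=; first by rewrite !subr0 addr0.
by rewrite subn1/= -natr1 !mulrDl !mulrBr mul1r; ring.
Qed.

Lemma sum_shift_bdiff b a n :
  \sum_(1 <= i < b.+1) nshift i (bdiff a) n = nshift 1 a n - nshift b.+1 a n.
Proof.
under eq_bigr do rewrite shift_bdiff.
rewrite (@telescope_sumr_eq _ _ _ (fun i => - nshift i a n))//; first ring.
by move=> i _; ring.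
Qed.

Lemma bdiff_indicator c n : bdiff (fun n => (c <= n)%N%:R) n = (n == c)%:R.
Proof.
rewrite /bdiff /nshift; case: n => [|n] /=; first by rewrite subr0 leqn0 eq_sym.
rewrite subn1/= (leq_eqVlt c n.+1) ltnS; case: (eqVneq c n.+1) => [->|_] /=.
  by rewrite ltnn subr0.
by rewrite subrr.
Qed.

Lemma eq_bdiff a a' n : a =1 a' -> bdiff a n = bdiff a' n.
Proof. by move=> aa'; rewrite /bdiff /nshift !aa'. Qed.

Lemma bdiffD a a' n : bdiff (fun n => a n + a' n) n = bdiff a n + bdiff a' n.
Proof. by rewrite /bdiff /nshift; case: ifP => _; rewrite ?subr0// opprD addrACA. Qed.

Lemma bdiffZ c a n : bdiff (fun n => c * a n) n = c * bdiff a n.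
Proof. by rewrite /bdiff /nshift; case: ifP => _; rewrite ?subr0// mulrBr. Qed.

Lemma bdiff_sum (I : Type) (s : seq I) (F : I -> nat -> R) n :
  bdiff (fun n => \sum_(i <- s) F i n) n = \sum_(i <- s) bdiff (F i) n.
Proof.
by rewrite /bdiff /nshift; case: ifP => _; rewrite ?subr0 -?sumrB//;
  apply: eq_bigr => i _; rewrite ?subr0.
Qed.

Lemma bdiff_shift b a n : bdiff (nshift b a) n = nshift b (bdiff a) n.
Proof. by rewrite shift_bdiff /bdiff shift_shift. Qed.

End shifts.

Section tails.
Variables (R : realType) (m : nat) (f : nat -> R).
Hypothesis hf : is_bundle_pmf m f.

Lemma bundle_tailE j : bundle_tail f j = \sum_(b < m | (j <= b)%N) f b.+1.
Proof.
have f0 : f 0%N = 0 by case: hf => _ + _; apply.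
rewrite /bundle_tail /bundle_cdf big_ord_recl f0 add0r -(sum_pmf_ord hf).
have -> : \sum_(i < j) f (lift ord0 i) = \sum_(b < m | (b < j)%N) f b.+1.
  under eq_bigr do rewrite lift0.
  rewrite (big_ord_widen (m + j) (fun i => f i.+1)) ?leq_addl//.
  rewrite [RHS](big_ord_widen_cond (m + j) (fun b => b < j)%N (fun i => f i.+1)) ?leq_addr//.
  rewrite (bigID (fun i : 'I_(m + j) => i < m)%N)/= [X in _ + X]big1 ?addr0//.
  by move=> i /andP[_ im]; case: hf => _ + _; apply; lia.
rewrite (bigID (fun b : 'I_m => b < j)%N)/= addrAC subrr add0r.
by apply: eq_bigl => b; rewrite -leqNgt.
Qed.

Lemma bundle_tail_ge0 j : 0 <= bundle_tail f j.
Proof. by rewrite bundle_tailE sumr_ge0// => b _; case: hf. Qed.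

Lemma bundle_tail_le1 j : bundle_tail f j <= 1.
Proof.
rewrite bundle_tailE -(sum_pmf_ord hf) [leRHS](bigID (fun b : 'I_m => j <= b)%N)/=.
by rewrite lerDl sumr_ge0// => b _; case: hf.
Qed.

(** Summation by parts against the distribution of the size. *)
Lemma sum_tail (a : nat -> R) :
  \sum_(b < m) f b.+1 * \sum_(1 <= i < b.+1) a i =
  \sum_(1 <= i < m) bundle_tail f i * a i.
Proof.
transitivity (\sum_(b < m) \sum_(1 <= i < m | (i <= b)%N) f b.+1 * a i).
  apply: eq_bigr => b _; rewrite mulr_sumr.
  rewrite [LHS]big_nat_cond [RHS]big_nat_cond (big_nat_widen _ _ m)//.
  apply: eq_bigl => i; have := ltn_ord b; lia.
rewrite (exchange_big_dep xpredT)//=; apply: eq_bigr => i _.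
by rewrite bundle_tailE mulr_suml.
Qed.

End tails.

(** * The equation for the second differences *)

Section curvature.
Variables (R : realType) (m : nat) (f : nat -> R) (lambda : R).
Hypotheses (hm : (0 < m)%N) (hf : is_bundle_pmf m f) (lambda0 : 0 < lambda).

Local Notation rho := (gap_mean m f lambda).

(** The derivative of [varphi] at [1], and the mean size minus one. *)
Definition tail_mass : R := \sum_(1 <= i < m) bundle_tail f i.
(** Lines shorter than [m] are kept apart: they cannot accept all sizes and do not
    follow the same equation. They feed the longer ones through [source]. *)
Definition long_mean t n : R := if (m <= n)%N then rho t n else 0.
Definition curvature t : nat -> R := bdiff (bdiff (long_mean t)).
Definition source t n : R := \sum_(1 <= i < m) rho t i *
  \sum_(b < m) f b.+1 * (n == maxn m (i + b.+1))%:R.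

Lemma gap_mean_len0 t : rho t 0 = 0.
Proof.
rewrite /gap_mean -[RHS](egf_const_seq 0 t); congr egf; apply/funext => N.
rewrite mul0rn; case: N => //= N; rewrite big1 ?mulr0// => b _.
by rewrite big_ord0 mulr0.
Qed.

(** Both sides of an accepted request contribute equally, and a line of [n >= m]
    packages accepts requests at rate [lambda * (n - tail_mass)]. *)
Lemma gap_drift_long t n : (m <= n)%N -> gap_drift m f lambda t n =
  lambda * (2 * (\sum_(b < m) f b.+1 * \sum_(j < n - b) rho t j)
    - (n%:R - tail_mass) * rho t n).
Proof.
move=> mn; rewrite /gap_drift; congr (_ * _).
transitivity (\sum_(b < m) (2 * (f b.+1 * \sum_(j < n - b) rho t j)
   - (f b.+1 * n%:R - f b.+1 * (\sum_(1 <= i < b.+1) 1)) * rho t n)).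
  apply: eq_bigr => b _; rewrite sumrB big_split/=.
  have -> : \sum_(j < n - b) rho t (n - b.+1 - j) = \sum_(j < n - b) rho t j.
    rewrite [RHS](reindex_inj rev_ord_inj); apply: eq_bigr => j _ /=.
    by congr rho; have := ltn_ord j; lia.
  rewrite sumr_const_nat sumr_const card_ord subn1 /= -(mulr_natr (rho t n)).
  have bn : (b <= n)%N by have := ltn_ord b; lia.
  rewrite natrB//; ring.
rewrite sumrB -mulr_sumr -mulr_suml sumrB -mulr_suml (sum_pmf_ord hf) mul1r.
rewrite (sum_tail hf) /tail_mass.
by under [X in _ - (_ - X) * _]eq_bigr do rewrite mulr1.
Qed.

(** The contribution of the lines shorter than [m] to the sums in
    [gap_drift_long]. *)
Definition long_source t n : R := \sum_(1 <= i < m) rho t i *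
  \sum_(b < m) f b.+1 * (maxn m (i + b.+1) <= n)%N%:R.

Lemma is_derive_long_mean t n : is_derive t (1 : R) (long_mean ^~ n)
  (lambda * (2 * (\sum_(b < m) f b.+1 * \sum_(j < n - b) long_mean t j)
    + 2 * long_source t n - (n%:R * long_mean t n - tail_mass * long_mean t n))).
Proof.
have [mn|nm] := leqP m n; last first.
  rewrite [X in is_derive _ _ X](_ : _ = cst 0); last first.
    by apply/funext => s; rewrite /long_mean leqNgt nm.
  apply: is_derive_rewrite (is_derive_cst _ _ _) _.
  rewrite {2 3}/long_mean leqNgt nm /= /long_source [X in 2 * X + _]big1; last first.
    move=> b _; rewrite big1 ?mulr0// => j _.
    by rewrite /long_mean leqNgt (leq_trans (ltn_ord j))// leq_subLR; lia.
  rewrite [X in _ + 2 * X]big1; first by ring.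
  move=> i _; rewrite big1 ?mulr0// => b _.
  by rewrite geq_max leqNgt nm/= mulr0.
rewrite [X in is_derive _ _ X](_ : _ = rho ^~ n); last first.
  by apply/funext => s; rewrite /long_mean mn.
apply: is_derive_rewrite (is_derive_gap_mean hf lambda0 t n) _.
rewrite gap_drift_long//; congr (_ * _).
rewrite {2 3}/long_mean mn -mulrDr mulrBl; congr (2 * _ - _).
rewrite /long_source; under [X in _ + X]eq_bigr do rewrite mulr_sumr.
rewrite exchange_big/= -big_split/=; apply: eq_bigr => b _.
under [X in _ + X]eq_bigr do rewrite mulrCA.
rewrite -mulr_sumr -mulrDr; congr (_ * _).
rewrite -!(big_mkord xpredT) (bigID (fun j => m <= j)%N)/=; congr (_ + _).
  by rewrite big_mkcond.
transitivity (\sum_(0 <= j < m | (j < n - b)%N) rho t j).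
  rewrite (big_nat_widen _ _ n) ?leq_subr// [RHS](big_nat_widen _ _ n)//.
  by apply: eq_bigl => j; rewrite -ltnNge andbC.
rewrite [LHS]big_ltn_cond//= gap_mean_len0 add0r if_same big_mkcond/=.
rewrite big_nat [RHS]big_nat; apply: eq_bigr => i im.
have -> : (maxn m (i + b.+1) <= n)%N = (i < n - b)%N by have := ltn_ord b; lia.
by case: ifP; rewrite ?mulr1 ?mulr0.
Qed.

Lemma bdiff_long_source t n : bdiff (long_source t) n = source t n.
Proof.
rewrite /long_source bdiff_sum; apply: eq_bigr => i _.
rewrite bdiffZ bdiff_sum; congr (_ * _); apply: eq_bigr => b _.
by rewrite bdiffZ bdiff_indicator.
Qed.

Lemma is_derive_bdiff (a : R -> nat -> R) a' t n :
  (forall k, is_derive t (1 : R) (a ^~ k) (a' k)) ->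
  is_derive t (1 : R) (fun s => bdiff (a s) n) (bdiff a' n).
Proof.
move=> aa'; rewrite /bdiff /nshift; case: (1 <= n)%N; last first.
  rewrite /= subr0 (_ : (fun s => _) = a ^~ n)//.
  by apply/funext => s; rewrite subr0.
exact: is_derive_subf.
Qed.

Lemma bdiff_drift (r Q : nat -> R) n :
  bdiff (fun n => 2 * (\sum_(b < m) f b.+1 * \sum_(j < n - b) r j)
     + 2 * Q n - (n%:R * r n - tail_mass * r n)) n =
  2 * (\sum_(b < m) f b.+1 * nshift b.+1 r n) + 2 * bdiff Q n
     - (n%:R * bdiff r n + nshift 1 r n - tail_mass * bdiff r n).
Proof.
transitivity (bdiff (fun n => 2 * (\sum_(b < m) f b.+1 * \sum_(j < n - b) r j)
     + (2 * Q n + ((-1) * (n%:R * r n) + tail_mass * r n))) n).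
  by apply: eq_bdiff => k; ring.
rewrite bdiffD bdiffZ bdiff_sum bdiffD bdiffZ bdiffD !bdiffZ bdiff_mulnat.
under eq_bigr do rewrite bdiffZ bdiff_prefix_sum.
ring.
Qed.

(** The differences of [n * r n] produce twice [nshift 1 (bdiff r)], which cancels
    the main part of the sum over sizes; the rest telescopes into tails. *)
Lemma bdiff2_drift (r Q : nat -> R) n :
  bdiff (bdiff (fun n => 2 * (\sum_(b < m) f b.+1 * \sum_(j < n - b) r j)
     + 2 * Q n - (n%:R * r n - tail_mass * r n))) n =
  2 * bdiff (bdiff Q) n - (n%:R - tail_mass) * bdiff (bdiff r) n
  - 2 * \sum_(1 <= i < m) bundle_tail f i * nshift i (bdiff (bdiff r)) n.
Proof.
rewrite (eq_bdiff _ (bdiff_drift r Q)) -(sum_tail hf).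
have Hs b k : bdiff (nshift b r) k = nshift b (bdiff r) k by exact: bdiff_shift.
move: (bdiff r) (bdiff Q) Hs => d q Hs.
transitivity (bdiff (fun n => 2 * (\sum_(b < m) f b.+1 * nshift b.+1 r n)
     + (2 * q n + ((-1) * (n%:R * d n) + ((-1) * nshift 1 r n
     + tail_mass * d n)))) n).
  by apply: eq_bdiff => k; ring.
rewrite bdiffD bdiffZ bdiff_sum bdiffD bdiffZ !bdiffD !bdiffZ bdiff_mulnat Hs.
have -> : \sum_(b < m) bdiff (fun n => f b.+1 * nshift b.+1 r n) n =
  nshift 1 d n - \sum_(b < m) f b.+1 *
    \sum_(1 <= i < b.+1) nshift i (bdiff d) n.
  rewrite -[X in X - _]mul1r -(sum_pmf_ord hf) mulr_suml -sumrB.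
  apply: eq_bigr => b _; rewrite bdiffZ Hs sum_shift_bdiff; ring.
ring.
Qed.

(** The generating series of [long_mean] behaves like a multiple of
    [(1 - X) ^ -2]; multiplying by [(1 - X) ^ 2] leaves coefficients which follow
    a damped recursion of bounded range. *)
Lemma is_derive_curvature t n : is_derive t (1 : R) (curvature ^~ n)
  (lambda * (2 * (source t n - nshift 1 (source t) n)
     - (n%:R - tail_mass) * curvature t n
     - 2 * \sum_(1 <= i < m) bundle_tail f i * nshift i (curvature t) n)).
Proof.
have D k := is_derive_bdiff k (is_derive_long_mean t).
apply: is_derive_rewrite (is_derive_bdiff n D) _.
rewrite -/(bdiff (source t) n) -(eq_bdiff _ (bdiff_long_source t)) -bdiff2_drift.
rewrite -bdiffZ; apply: eq_bdiff => k; rewrite -bdiffZ; exact: eq_bdiff.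
Qed.

End curvature.

(** * The second differences vanish at infinity *)

Section linear_comparison.
Variable R : realType.
Implicit Types (y g : R -> R) (a b B T : R).

Lemma derive_le0_nonincreasing (h dh : R -> R) a b : a <= b ->
  (forall x, is_derive x (1 : R) h (dh x)) ->
  (forall x, a <= x <= b -> dh x <= 0) -> h b <= h a.
Proof.
rewrite le_eqVlt => /predU1P[-> //|ab hd dh0].
have [|c] := @MVT _ h dh a b ab (fun x _ => hd x).
  exact/continuous_subspaceT/(is_derive_continuous hd).
rewrite in_itv/= => /andP[ac cb] E; rewrite -subr_le0 E.
by rewrite mulr_le0_ge0 ?subr_ge0 ?(ltW ab)// dh0// !ltW.
Qed.

(** [e^(a s) (y s - B / a)] is nonincreasing when [g <= B]. *)
Lemma linear_decay_le y g a B T : 0 < a -> 0 <= T ->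
  (forall s, is_derive s (1 : R) y (g s - a * y s)) ->
  (forall s, 0 <= s <= T -> g s <= B) -> y 0 <= B / a -> y T <= B / a.
Proof.
move=> a0 T0 yd gB y0.
pose h s := expR (a * s) * (y s - B / a).
have hd s : is_derive s (1 : R) h (expR (a * s) * (g s - B)).
  have D1 : is_derive s (1 : R) (fun s => a * s) (a * 1).
    exact: is_derive_scalef (is_derive_id _ _).
  have D2 := is_derive_compf (is_derive_expR (a * s)) D1.
  have D3 := is_derive_subf (yd s) (is_derive_cst (B / a) s 1).
  apply: is_derive_rewrite (is_derive_mulf D2 D3) _.
  rewrite mulr1 subr0 -mulrA -mulrDr; congr (_ * _).
  by rewrite mulrBr mulrCA mulfV ?gt_eqF// mulr1; ring.
have : h T <= h 0.
  apply: (derive_le0_nonincreasing T0 hd) => s sT.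
  by rewrite mulr_ge0_le0 ?expR_ge0// subr_le0 gB.
rewrite /h mulr0 expR0 mul1r => hT.
have : expR (a * T) * (y T - B / a) <= 0 by apply: le_trans hT _; rewrite subr_le0.
by rewrite pmulr_rle0 ?expR_gt0// subr_le0.
Qed.

Lemma linear_decay y g a B T : 0 < a -> 0 <= T ->
  (forall s, is_derive s (1 : R) y (g s - a * y s)) ->
  (forall s, 0 <= s <= T -> `|g s| <= B) -> `|y 0| <= B / a -> `|y T| <= B / a.
Proof.
move=> a0 T0 yd gB; rewrite !ler_norml => /andP[y0 y0'].
apply/andP; split; last first.
  by apply: (linear_decay_le a0 T0 yd) => // s /gB; rewrite ler_norml => /andP[].
rewrite lerNl; apply: (@linear_decay_le (fun s => - y s) (fun s => - g s)) => //.
- move=> s; have D := is_derive_scalef (-1) (yd s).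
  rewrite (_ : (fun s => - y s) = fun s => -1 * y s); last first.
    by apply/funext => u; rewrite mulN1r.
  by apply: is_derive_rewrite D _; ring.
- by move=> s /gB; rewrite ler_norml => /andP[]; rewrite lerNl.
- by rewrite lerNl.
Qed.

End linear_comparison.

Section curvature_bounds.
Variables (R : realType) (m : nat) (f : nat -> R) (lambda : R).
Hypotheses (hm : (0 < m)%N) (hf : is_bundle_pmf m f) (lambda0 : 0 < lambda).

Local Notation rho := (gap_mean m f lambda).
Local Notation k_ := (curvature m f lambda).
Local Notation tau := (tail_mass m f).

Lemma tail_mass_le : 0 <= tau <= m%:R.
Proof.
rewrite /tail_mass; apply/andP; split.
  by apply: sumr_ge0 => i _; exact: bundle_tail_ge0 hf i.
apply: (@le_trans _ _ (\sum_(1 <= i < m) 1)).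
  by apply: ler_sum => i _; exact: bundle_tail_le1 hf i.
by rewrite sumr_const_nat ler_nat leq_subr.
Qed.

Lemma bdiff_linear_bound (a : nat -> R) c n : (forall k, `|a k| <= c * k%:R) ->
  `|bdiff a n| <= 2 * c * n%:R.
Proof.
move=> ac; apply: (le_trans (ler_normB _ _)).
rewrite -mulrA [2 * _]mulr_natl mulr2n lerD// /nshift; case: ifP => _.
  apply: (le_trans (ac _)); rewrite ler_wpM2l ?ler_nat ?leq_subr//.
  by have := ac 1%N; rewrite mulr1; apply: le_trans.
rewrite normr0; exact: le_trans (ac n).
Qed.

Lemma curvature_crude t n : 0 <= t -> `|k_ t n| <= 4 * n%:R.
Proof.
move=> t0; have -> : 4 = 2 * (2 * 1) :> R by ring.
apply: bdiff_linear_bound => k; apply: bdiff_linear_bound => j.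
rewrite mul1r /long_mean; case: ifP => _; last by rewrite normr0.
exact: gap_mean_bounded hf lambda0 _ _ t0.
Qed.

(** Initially [long_mean] is zero below [m] and the identity from [m] on. *)
Lemma curvature_at0 n : k_ 0 n = m%:R * (n == m)%:R - (m%:R - 1) * (n == m.+1)%:R.
Proof.
have S1 c j : nshift 1 (fun n => (c <= n)%N%:R) j = (c.+1 <= j)%N%:R :> R.
  by rewrite /nshift; case: j => [|j] /=; rewrite ?subn1.
have S2 c j : nshift 1 (fun n => (n == c)%:R) j = (j == c.+1)%:R :> R.
  by rewrite /nshift; case: j => [|j] /=; rewrite ?subn1.
have E1 j : bdiff (long_mean m f lambda 0) j =
    m%:R * (j == m)%:R + (m.+1 <= j)%N%:R.
  rewrite -S1 -[in RHS](bdiff_indicator R m) /=.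
  transitivity (bdiff (fun j => j%:R * (m <= j)%N%:R : R) j).
    apply: eq_bdiff => i; rewrite /long_mean gap_mean_at0.
    by case: ifP; rewrite ?mulr1 ?mulr0.
  rewrite bdiff_mulnat bdiff_indicator; congr (_ + _).
  by case: eqVneq => [->//|]; rewrite !mulr0.
rewrite /curvature (eq_bdiff _ E1) bdiffD bdiffZ bdiff_indicator /bdiff S2; ring.
Qed.

Lemma source_large t n : (2 * m <= n)%N -> source m f lambda t n = 0.
Proof.
move=> mn; rewrite /source big_nat big1// => i im.
rewrite big1 ?mulr0// => b _; have := ltn_ord b => bm.
have /negbTE -> : n != maxn m (i + b.+1) by lia.
by rewrite mulr0.
Qed.

(** For [n >= 3 * m] both the source and the initial value vanish, and the forcing
    by the previous coefficients is at most [lambda * (2 * m * K)]. *)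
Lemma curvature_step n t K : (3 * m <= n)%N -> 0 <= t -> 0 <= K ->
  (forall s j, 0 <= s <= t -> (j < n)%N -> `|k_ s j| <= K) ->
  `|k_ t n| <= 2 * m%:R * K / (n%:R - m%:R).
Proof.
move=> mn t0 K0 HK.
have /andP[tau0 taum] := tail_mass_le.
have nm : 0 < n%:R - m%:R :> R by rewrite subr_gt0 ltr_nat; lia.
have a0 : 0 < lambda * (n%:R - tau).
  by rewrite mulr_gt0// (lt_le_trans nm)// lerB.
apply: (@le_trans _ _ (lambda * (2 * m%:R * K) / (lambda * (n%:R - tau)))); last first.
  rewrite -mulf_div divff ?gt_eqF// mul1r ler_wpM2l ?mulr_ge0//.
  by rewrite lef_pV2 ?posrE ?lerB// (lt_le_trans nm)// lerB.
apply: (@linear_decay _ (k_ ^~ n) (fun s => lambda * (2 * (source m f lambda s n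
   - nshift 1 (source m f lambda s) n)
   - 2 * \sum_(1 <= i < m) bundle_tail f i * nshift i (k_ s) n))) => //.
- move=> s; apply: is_derive_rewrite (is_derive_curvature hm hf lambda0 s n) _.
  ring.
- move=> s st; rewrite source_large; last lia.
  have -> : nshift 1 (source m f lambda s) n = 0.
    by rewrite /nshift; case: ifP => // _; rewrite source_large//; lia.
  rewrite subrr mulr0 sub0r normrM (gtr0_norm lambda0) (ler_wpM2l (ltW lambda0))//.
  rewrite normrN normrM normr_nat -mulrA ler_wpM2l//.
  apply: (le_trans (ler_norm_sum _ _ _)).
  apply: (@le_trans _ _ (\sum_(1 <= i < m) K)).
    rewrite big_nat [leRHS]big_nat; apply: ler_sum => i im.
    rewrite normrM -[leRHS]mul1r ler_pM//.
      by rewrite ger0_norm ?(bundle_tail_ge0 hf)// (bundle_tail_le1 hf).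
    by rewrite /nshift; case: ifP => _; rewrite ?normr0// HK//; lia.
  by rewrite sumr_const_nat mulr_natl; apply: ler_wpMn2l => //; exact: leq_subr.
- rewrite curvature_at0.
  have /negbTE -> : n != m by lia.
  have /negbTE -> : n != m.+1 by lia.
  rewrite !mulr0 subrr normr0; apply: divr_ge0; last exact: ltW.
  by apply: mulr_ge0; [exact: ltW|rewrite !mulr_ge0].
Qed.

(** Below [3 * m] this is the crude bound; beyond, the damping rate is at least
    [lambda * (2 * m)] and [curvature_step] reproduces the bound. *)
Lemma curvature_bounded t n : 0 <= t -> `|k_ t n| <= 12 * m%:R.
Proof.
elim/ltn_ind: n t => n IH t t0; have [mn|nm] := leqP (3 * m) n; last first.
  apply: (le_trans (curvature_crude n t0)).
  by rewrite -!natrM ler_nat; lia.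
have m0 : 0 <= 12 * m%:R :> R by rewrite mulr_ge0.
have nm : 0 < n%:R - m%:R :> R by rewrite subr_gt0 ltr_nat; lia.
apply: (le_trans (curvature_step mn t0 m0 _)) => [s j /andP[s0 _] jn|].
  exact: IH.
rewrite ler_pdivrMr// mulrC ler_wpM2l// lerBrDr -natrM -natrD ler_nat; lia.
Qed.

(** The forcing is bounded while the damping rate grows with [n]. *)
Lemma curvature_vanishes e : 0 < e ->
  exists N0, forall n t, (N0 <= n)%N -> 0 <= t -> `|k_ t n| <= e.
Proof.
move=> e0; pose C : R := 2 * m%:R * (12 * m%:R).
have C0 : 0 <= C by rewrite !mulr_ge0.
exists (3 * m + m + (Num.bound (C / e)))%N => n t nN t0.
have nm : 0 < n%:R - m%:R :> R by rewrite subr_gt0 ltr_nat; lia.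
apply: (le_trans (curvature_step _ t0 (K := 12 * m%:R) _ _)).
- lia.
- by rewrite mulr_ge0.
- by move=> s j /andP[s0 _] _; exact: curvature_bounded.
rewrite -/C ler_pdivrMr// mulrC -ler_pdivrMr//.
apply: (le_trans (ltW (archi_boundP _))); first by rewrite divr_ge0// ltW.
rewrite lerBrDr -natrD ler_nat; move: (Num.bound _) nN => b nN; lia.
Qed.

End curvature_bounds.

(** * Integrals of approximate derivatives *)

Section FTC.
Variable R : realType.
Local Notation mu := (@lebesgue_measure R).

Lemma derivable_continuous_itv (F dF : R -> R) (a b : R) :
  (forall x, a <= x <= b -> is_derive x (1 : R) F (dF x)) ->
  {within `[a, b], continuous F}.
Proof.
move=> Fd; apply: continuous_in_subspaceT => x; rewrite inE/= in_itv/= => xab.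
apply: differentiable_continuous; apply/derivable1_diffP.
exact: (@ex_derive _ _ _ _ _ _ _ (Fd x xab)).
Qed.

Lemma FTC_integral (F dF : R -> R) (a b : R) : a < b ->
  (forall x, a <= x <= b -> is_derive x (1 : R) F (dF x)) ->
  {within `[a, b], continuous dF} ->
  \int[mu]_(x in `[a, b]) dF x = F b - F a.
Proof.
move=> ab Fd cdF; have cF := derivable_continuous_itv Fd.
rewrite /Rintegral (@continuous_FTC2 _ _ F)//.
- have [Fa Fb] := (continuous_within_itvP _ ab).1 cF.
  split => //.
  by move=> x; rewrite in_itv/= => /andP[ax xb]; have := Fd x; rewrite !ltW//= => /(_ isT) D; exact: ex_derive.
- move=> x; rewrite in_itv/= => /andP[ax xb]; have := Fd x; rewrite !ltW//= => /(_ isT) D.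
  by rewrite derive1E; exact: derive_val.
Qed.

Lemma continuous_itv_integrable (g : R -> R) (a b : R) :
  {within `[a, b], continuous g} -> mu.-integrable `[a, b] (EFin \o g).
Proof. by move=> cg; apply: continuous_compact_integrable => //; exact: segment_compact. Qed.

(** Adding a linear function of slope [e] or [- e] to [F] makes its derivative
    larger or smaller than [h], so that monotonicity of the integral suffices. *)
Lemma FTC_approx (F dF h : R -> R) (a b e : R) : a < b ->
  (forall x, a <= x <= b -> is_derive x (1 : R) F (dF x)) ->
  {within `[a, b], continuous dF} -> {within `[a, b], continuous h} ->
  (forall x, a <= x <= b -> `|dF x - h x| <= e) ->
  `|F b - F a - \int[mu]_(x in `[a, b]) h x| <= e * (b - a).
Proof.
move=> ab Fd cdF ch dFh.
have shift_int (c : R) : \int[mu]_(x in `[a, b]) (dF x + c) = F b - F a + c * (b - a).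
  have D (x : R) : a <= x <= b -> is_derive x (1 : R) (fun x => F x + c * x) (dF x + c * 1).
    by move=> xab; exact: is_derive_addf (Fd x xab) (is_derive_scalef c (is_derive_id _ _)).
  have := FTC_integral ab D; rewrite mulr1 => ->; first by ring.
  by move=> x; apply: cvgD; [exact: cdF|exact: cvg_cst].
have icont (c : R) : {within `[a, b], continuous (fun x => dF x + c)}.
  by move=> x; apply: cvgD; [exact: cdF|exact: cvg_cst].
have up : \int[mu]_(x in `[a, b]) h x <= F b - F a + e * (b - a).
  rewrite -shift_int; apply: le_Rintegral => //; try exact: continuous_itv_integrable.
  move=> x /=; rewrite in_itv/= => xab.
  by have := dFh x xab; rewrite ler_norml => /andP[+ _]; lra.
have lo : F b - F a + - e * (b - a) <= \int[mu]_(x in `[a, b]) h x.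
  rewrite -shift_int; apply: le_Rintegral => //; try exact: continuous_itv_integrable.
  move=> x /=; rewrite in_itv/= => xab.
  by have := dFh x xab; rewrite ler_norml => /andP[_]; lra.
by rewrite ler_norml; apply/andP; split; lra.
Qed.
End FTC.

(** * Integration along a characteristic *)

Section characteristics.
Variables (R : realType) (m : nat) (f : nat -> R) (lambda t : R).
Hypotheses (hm : (0 < m)%N) (hf : is_bundle_pmf m f) (lambda0 : 0 < lambda).

Local Notation rho := (gap_mean m f lambda).
Local Notation k_ := (curvature m f lambda).
Local Notation src := (source m f lambda).
Local Notation tau := (tail_mass m f).
Local Notation phi := (varphi m f).
Implicit Types (u : R) (N n i : nat).

(** The characteristic through time [t] and [u = 1]; it reaches time [0] at [u = expR (- (lambda * t))]. *)
Definition clock u : R := t + ln u / lambda.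
Definition tail_poly u : R := \sum_(1 <= i < m) bundle_tail f i * u ^+ i.
Definition damping u : R := expR (- tau * ln u) * expR (2 * (phi u - phi 1)).
Definition curvature_poly N u : R := \sum_(n < N.+1) k_ (clock u) n * u ^+ n.
(** The part of the shifted sums that falls beyond the index [N]. *)
Definition truncation_error N u : R := \sum_(1 <= i < m) bundle_tail f i * u ^+ i *
  \sum_(n < N.+1 | (N < n + i)%N) k_ (clock u) n * u ^+ n.
(** The integrand of [alpha]. *)
Definition flux u : R :=
  expR (2 * (phi u - phi 1)) * q_hat m f rho (clock u) u.

Lemma is_derive_clock u : 0 < u -> is_derive u (1 : R) clock (u^-1 / lambda).
Proof.
move=> u0; have D1 := is_derive1_ln u0.
have D2 := is_derive_mulf D1 (is_derive_cst lambda^-1 u 1).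
have D3 := is_derive_addf (is_derive_cst t u 1) D2.
by apply: is_derive_rewrite D3 _; rewrite mulr0 addr0 add0r.
Qed.

Lemma is_derive_varphi u : 0 < u -> is_derive u (1 : R) phi (tail_poly u / u).
Proof.
move=> u0; rewrite /tail_poly mulr_suml.
have D i : is_derive u (1 : R) (fun u => bundle_tail f i / i%:R * u ^+ i)
    (bundle_tail f i / i%:R * (i%:R * u ^+ i.-1)).
  exact: is_derive_scalef (is_derive_expf u i).
have := is_derive_sumf (index_iota 1 m) (P := xpredT) (fun i _ => D i).
move=> /is_derive_rewrite; apply.
rewrite big_nat [RHS]big_nat; apply: eq_bigr => i /andP[i0 _].
rewrite -mulrA mulKf ?pnatr_eq0 -?lt0n// -mulrA; congr (_ * _).
by case: i i0 => // i _; rewrite exprSr mulfK ?gt_eqF.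
Qed.

Lemma derive1_varphi1 : derive1 phi 1 = tau.
Proof.
rewrite derive1E (@derive_val _ _ _ _ _ _ _ (is_derive_varphi ltr01)).
by rewrite divr1; apply: eq_bigr => i _; rewrite expr1n mulr1.
Qed.

(** Up to the terms pushed beyond [N], a shift is a multiplication by [u ^ i]. *)
Lemma sum_nshift (a : nat -> R) i N u :
  \sum_(n < N.+1) nshift i a n * u ^+ n =
  u ^+ i * (\sum_(n < N.+1) a n * u ^+ n
            - \sum_(n < N.+1 | (N < n + i)%N) a n * u ^+ n).
Proof.
rewrite [X in X - _](bigID (fun n : 'I_N.+1 => N < n + i)%N)/= addrAC subrr add0r.
rewrite -(big_mkord xpredT (fun n => nshift i a n * u ^+ n)).
rewrite -(big_mkord (fun n => ~~ (N < n + i)%N) (fun n => a n * u ^+ n)).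
have [iN|Ni] := leqP i N.+1; last first.
  rewrite [in LHS]big_nat big1 => [|n]; last first.
    by rewrite /nshift => /andP[_ nN]; rewrite leqNgt (leq_trans nN (ltnW Ni)) mul0r.
  rewrite big_nat_cond big1 ?mulr0// => n; lia.
rewrite (big_cat_nat _ iN)//= [X in X + _]big_nat big1 => [|n]; last first.
  by rewrite /nshift => /andP[_ ni]; rewrite leqNgt ni mul0r.
rewrite add0r -{1}[i]add0n big_addn mulr_sumr (big_nat_widen _ _ N.+1) ?leq_subr//.
rewrite big_nat_cond [RHS]big_nat_cond; apply: eq_big => [n|n]; first by lia.
by move=> _; rewrite /nshift leq_addl addnK exprD; ring.
Qed.

(** Along the characteristic, the derivative of [u ^ n] compensates the damping
    [n * k_n], so the equation closes on the polynomial itself. *)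
Lemma is_derive_curvature_poly N u : 0 < u -> (2 * m <= N)%N ->
  is_derive u (1 : R) (curvature_poly N)
    (u^-1 * (2 * (1 - u) * (\sum_(n < N.+1) src (clock u) n * u ^+ n)
      + (tau - 2 * tail_poly u) * curvature_poly N u
      + 2 * truncation_error N u)).
Proof.
move=> u0 mN; set s := clock u.
have D (n : 'I_N.+1) := is_derive_mulf (is_derive_compf (is_derive_curvature hm hf lambda0 s n)
   (is_derive_clock u0)) (is_derive_expf u n).
have := @is_derive_sumf R 'I_N.+1 (index_enum _) xpredT
  (fun (n : 'I_N.+1) u => k_ (clock u) n * u ^+ n) _ u (fun (n : 'I_N.+1) _ => D n).
move=> /is_derive_rewrite; apply.
transitivity (\sum_(n < N.+1) u^-1 * (2 * (src s n * u ^+ n)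
   - 2 * (nshift 1 (src s) n * u ^+ n) + tau * (k_ s n * u ^+ n)
   - 2 * \sum_(1 <= i < m) bundle_tail f i * (nshift i (k_ s) n * u ^+ n))).
  apply: eq_bigr => n _; rewrite -/s.
  have -> : n%:R * u ^+ n.-1 = u^-1 * (n%:R * u ^+ n).
    case: (nat_of_ord n) => [|j]; first by rewrite !mul0r mulr0.
    by rewrite exprS; field; rewrite gt_eqF.
  have -> : \sum_(1 <= i < m) bundle_tail f i * (nshift i (k_ s) n * u ^+ n) =
      (\sum_(1 <= i < m) bundle_tail f i * nshift i (k_ s) n) * u ^+ n.
    by rewrite mulr_suml; apply: eq_bigr => i _; rewrite mulrA.
  by field; rewrite !gt_eqF.
rewrite -mulr_sumr; congr (_ * _).
rewrite sumrB big_split sumrB/= -!mulr_sumr.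
rewrite exchange_big/=.
under [X in _ - 2 * X = _]eq_bigr do rewrite -mulr_sumr sum_nshift.
rewrite sum_nshift [X in u ^+ 1 * (_ - X)]big1; last first.
  by move=> n nN; rewrite source_large ?mul0r//; lia.
rewrite subr0 expr1 /curvature_poly /truncation_error -/s /tail_poly.
set Q := \sum_(n < N.+1) src s n * _; set K := \sum_(n < N.+1) k_ s n * _.
have -> : \sum_(1 <= i < m) bundle_tail f i * (u ^+ i *
    (K - \sum_(n < N.+1 | (N < n + i)%N) k_ s n * u ^+ n)) =
  (\sum_(1 <= i < m) bundle_tail f i * u ^+ i) * K -
  \sum_(1 <= i < m) bundle_tail f i * u ^+ i *
    \sum_(n < N.+1 | (N < n + i)%N) k_ s n * u ^+ n.
  by rewrite mulr_suml -sumrB; apply: eq_bigr => i _; ring.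
ring.
Qed.

Lemma is_derive_damping u : 0 < u ->
  is_derive u (1 : R) damping (damping u / u * (2 * tail_poly u - tau)).
Proof.
move=> u0.
have D1 := @is_derive_compf R expR (fun u => - tau * ln u) u _ _ (is_derive_expR _)
  (is_derive_scalef (- tau) (is_derive1_ln u0)).
have D2 := @is_derive_compf R expR (fun u => 2 * (phi u - phi 1)) u _ _ (is_derive_expR _)
  (is_derive_scalef 2 (is_derive_subf (is_derive_varphi u0) (is_derive_cst (phi 1) u 1))).
apply: is_derive_rewrite (is_derive_mulf D1 D2) _.
rewrite /damping; field; by rewrite gt_eqF.
Qed.

(** [damping] is the integrating factor of [is_derive_curvature_poly]. *)
Lemma is_derive_potential N u : 0 < u -> (2 * m <= N)%N ->
  is_derive u (1 : R) (fun u => damping u * curvature_poly N u)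
    (damping u / u * (2 * (1 - u) * (\sum_(n < N.+1) src (clock u) n * u ^+ n)
      + 2 * truncation_error N u)).
Proof.
move=> u0 mN.
apply: is_derive_rewrite (is_derive_mulf (is_derive_damping u0)
  (is_derive_curvature_poly u0 mN)) _.
by field; rewrite gt_eqF.
Qed.

(** The powers [u ^ maxn m (i + b)] stay at [u ^ m] up to [b = m - i] and then
    telescope. *)
Lemma sum_pmf_max i u : (1 <= i < m)%N ->
  \sum_(b < m) f b.+1 * u ^+ maxn m (i + b.+1) =
  u ^+ m - (1 - u) * \sum_(m - i <= j < m) bundle_tail f j * u ^+ (i + j).
Proof.
move=> im.
pose a j : R := if (m - i <= j)%N then u ^+ (i + j).+1 - u ^+ (i + j) else 0.
have E (b : 'I_m) : u ^+ maxn m (i + b.+1) = u ^+ m + \sum_(1 <= j < b.+1) a j.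
  rewrite (telescope_sumr_eq (fun j => u ^+ maxn m (i + j)))//.
    rewrite (_ : maxn m (i + 1) = m); last by lia.
    by rewrite addrC subrK.
  move=> j _; rewrite /a; case: ifP => ij.
    by congr (_ ^+ _ - _ ^+ _); lia.
  have -> : maxn m (i + j.+1) = m by lia.
  have -> : maxn m (i + j) = m by lia.
  by rewrite subrr.
under eq_bigr do rewrite E mulrDr.
rewrite big_split/= -mulr_suml (sum_pmf_ord hf) mul1r (sum_tail hf).
rewrite -mulNr mulr_sumr; congr (_ + _).
rewrite (@big_cat_nat _ _ _ (m - i)%N)/=; [|lia..].
rewrite big_nat big1 ?add0r => [|j jm]; last first.
  by rewrite /a ifF ?mulr0//; lia.
rewrite big_nat [RHS]big_nat; apply: eq_bigr => j jm.
by rewrite /a ifT; [rewrite exprS; ring|lia].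
Qed.

Lemma sum_source N u : (2 * m <= N)%N ->
  \sum_(n < N.+1) src (clock u) n * u ^+ n =
  \sum_(1 <= i < m) rho (clock u) i *
    (u ^+ m - (1 - u) * \sum_(m - i <= j < m) bundle_tail f j * u ^+ (i + j)).
Proof.
move=> mN; rewrite /source; under eq_bigr do rewrite mulr_suml.
rewrite exchange_big/= big_nat [RHS]big_nat; apply: eq_bigr => i im.
rewrite -sum_pmf_max//.
transitivity (rho (clock u) i * \sum_(n < N.+1) \sum_(b < m)
    f b.+1 * (val n == maxn m (i + b.+1))%:R * u ^+ n).
  by rewrite mulr_sumr; apply: eq_bigr => n _; rewrite -mulrA mulr_suml.
congr (_ * _).
rewrite exchange_big/=; apply: eq_bigr => b _.
have bN : (maxn m (i + b.+1) < N.+1)%N by have := ltn_ord b; lia.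
rewrite (bigD1 (Ordinal bN))//= eqxx mulr1 big1 ?addr0// => n nb.
by rewrite (_ : (_ == _) = false) ?mulr0 ?mul0r//; apply/negbTE.
Qed.

Lemma flux_source N u : 0 < u -> (2 * m <= N)%N ->
  damping u / u * (2 * (1 - u) * (\sum_(n < N.+1) src (clock u) n * u ^+ n))
  = flux u.
Proof.
move=> u0 mN; rewrite sum_source// /flux /damping /q_hat derive1_varphi1.
have pw (k : nat) : u `^ (k%:R - tau - 1) = u ^+ k * (expR (- tau * ln u) / u).
  rewrite /powR gt_eqF// !mulrBl mul1r -mulNr.
  by rewrite 2!expRD expRN expRM_natl lnK ?posrE// -mulrA.
under [X in _ = _ * (_ - _ * X)]eq_bigr => i _.
  under eq_bigr => j _ do rewrite -natrD pw mulrA.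
  rewrite -mulr_suml.
  over.
rewrite pw; set W := expR (- tau * ln u) / u.
rewrite [X in _ = _ * (_ - _ * X)](_ : _ = W * \sum_(1 <= i < m) rho (clock u) i *
   \sum_(m - i <= j < m) bundle_tail f j * u ^+ (i + j)); last first.
  by rewrite mulr_sumr; apply: eq_bigr => i _; ring.
have -> : \sum_(1 <= i < m) rho (clock u) i *
    (u ^+ m - (1 - u) * \sum_(m - i <= j < m) bundle_tail f j * u ^+ (i + j)) =
  (\sum_(1 <= i < m) rho (clock u) i) * u ^+ m - (1 - u) *
   \sum_(1 <= i < m) rho (clock u) i *
     \sum_(m - i <= j < m) bundle_tail f j * u ^+ (i + j).
  by rewrite mulr_suml mulr_sumr -sumrB; apply: eq_bigr => i _; ring.
rewrite [_ * expR (2 * _) / u]mulrAC -/W; ring.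
Qed.

End characteristics.

(** * The growth of the mean in the length of the line *)

Section pointwise_continuity.
Variable R : realType.
Implicit Types (g h : R -> R) (u : R).

Definition continuous_pt g u := g x @[x --> u] --> g u.

Lemma continuous_pt_derive g u a : is_derive u (1 : R) g a -> continuous_pt g u.
Proof.
move=> D; apply: differentiable_continuous; apply/derivable1_diffP.
exact: ex_derive.
Qed.

Lemma continuous_pt_cst (c : R) u : continuous_pt (fun=> c) u.
Proof. exact: cvg_cst. Qed.

Lemma continuous_ptD g h u : continuous_pt g u -> continuous_pt h u ->
  continuous_pt (fun x => g x + h x) u.
Proof. exact: cvgD. Qed.

Lemma continuous_ptM g h u : continuous_pt g u -> continuous_pt h u ->
  continuous_pt (fun x => g x * h x) u.
Proof. exact: cvgM. Qed.

Lemma continuous_pt_exp u n : continuous_pt (fun x => x ^+ n) u.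
Proof. exact: continuous_pt_derive (is_derive_expf u n). Qed.

Lemma continuous_pt_sum (I : Type) (r : seq I) (P : pred I) (F : I -> R -> R) u :
  (forall i, continuous_pt (F i) u) ->
  continuous_pt (fun x => \sum_(i <- r | P i) F i x) u.
Proof.
move=> cF; rewrite /continuous_pt; elim: r => [|i r IH].
  rewrite big_nil (_ : (fun x => _) = fun=> 0); first exact: cvg_cst.
  by apply/funext => x; rewrite big_nil.
rewrite big_cons (_ : (fun x => _) = fun x =>
    if P i then F i x + \sum_(j <- r | P j) F j x else \sum_(j <- r | P j) F j x).
  by case: (P i) => //; apply: cvgD => //; exact: cF.
by apply/funext => x; rewrite big_cons.
Qed.

Lemma continuous_pt_within g (a b : R) :
  (forall u, a <= u <= b -> continuous_pt g u) -> {within `[a, b], continuous g}.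
Proof.
move=> cg; apply: continuous_in_subspaceT => u; rewrite inE/= in_itv/=.
exact: cg.
Qed.

End pointwise_continuity.

Section gap_growth.
Variables (R : realType) (m : nat) (f : nat -> R) (lambda t : R).
Hypotheses (hm : (0 < m)%N) (hf : is_bundle_pmf m f) (lambda0 : 0 < lambda).
Hypothesis t0 : 0 < t.

Local Notation rho := (gap_mean m f lambda).
Local Notation k_ := (curvature m f lambda).
Local Notation src := (source m f lambda).
Local Notation tau := (tail_mass m f).
Local Notation phi := (varphi m f).
Local Notation clock := (clock lambda t).
Local Notation damping := (damping m f).
Local Notation y := (expR (- (lambda * t))).

Definition potential_drift N (u : R) : R :=
  damping u / u * (2 * (1 - u) * (\sum_(n < N.+1) src (clock u) n * u ^+ n)).

Lemma clock_ge0 u : y <= u -> 0 <= clock u.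
Proof.
move=> yu; rewrite /clock -lerBlDl sub0r ler_pdivlMr// -[leLHS]expRK.
by rewrite mulNr mulrC ler_ln ?posrE ?expR_gt0// (lt_le_trans (expR_gt0 _) yu).
Qed.

Lemma y_lt1 : y < 1.
Proof. by rewrite -expR0 ltr_expR oppr_lt0 mulr_gt0. Qed.

Lemma continuous_drift_factor u : 0 < u -> continuous_pt (fun u => damping u / u) u.
Proof.
move=> u0; apply: continuous_ptM.
  exact: continuous_pt_derive (is_derive_damping m f u0).
by apply: cvgV; [rewrite gt_eqF|exact: cvg_id].
Qed.

Lemma continuous_source n u : 0 < u -> continuous_pt (fun u => src (clock u) n) u.
Proof.
move=> u0; apply: continuous_pt_sum => i; apply: continuous_ptM.
  exact: continuous_pt_derive (is_derive_compf
    (is_derive_gap_mean hf lambda0 (clock u) i) (is_derive_clock lambda t u0)).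
exact: continuous_pt_cst.
Qed.

Lemma continuous_potential_drift N u : 0 < u ->
  continuous_pt (potential_drift N) u.
Proof.
move=> u0; apply: continuous_ptM; first exact: continuous_drift_factor.
apply: continuous_ptM.
  apply: continuous_ptM; first exact: continuous_pt_cst.
  by apply: cvgB; [exact: cvg_cst|exact: cvg_id].
apply: continuous_pt_sum => n; apply: continuous_ptM; first exact: continuous_source.
exact: continuous_pt_exp.
Qed.

Lemma continuous_truncation_error N u : 0 < u ->
  continuous_pt (truncation_error m f lambda t N) u.
Proof.
move=> u0; apply: continuous_pt_sum => i; apply: continuous_ptM.
  by apply: continuous_ptM; [exact: continuous_pt_cst|exact: continuous_pt_exp].
apply: continuous_pt_sum => n; apply: continuous_ptM; last exact: continuous_pt_exp.
exact: continuous_pt_derive (is_derive_compf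
  (is_derive_curvature hm hf lambda0 (clock u) n) (is_derive_clock lambda t u0)).
Qed.

(** On this interval [ln u >= - lambda * t] and [phi u <= phi 1]. *)
Lemma drift_factor_bound : exists2 C : R, 0 < C & forall u, y <= u <= 1 ->
  0 <= damping u / u <= C.
Proof.
exists (expR (tau * (lambda * t)) * 1 / y).
  by rewrite mulr1 divr_gt0 ?expR_gt0.
move=> u /andP[yu u1]; have u0 := lt_le_trans (expR_gt0 _) yu.
have /andP[tau0 _] := tail_mass_le hf.
apply/andP; split; first by rewrite divr_ge0 ?mulr_ge0 ?expR_ge0// ltW.
apply: ler_pM; rewrite ?invr_ge0 ?mulr_ge0 ?expR_ge0 ?(ltW u0)//; last first.
  by rewrite lef_pV2 ?posrE ?expR_gt0.
apply: ler_pM; rewrite ?expR_ge0//.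
  rewrite ler_expR mulNr -mulrN ler_wpM2l// lerNl -[leLHS]expRK.
  by rewrite ler_ln ?posrE ?expR_gt0.
rewrite -[leRHS]expR0 ler_expR pmulr_rle0// subr_le0.
apply: ler_sum => i _; rewrite ler_wpM2l ?divr_ge0 ?(bundle_tail_ge0 hf)//.
by apply: lerXn2r; rewrite ?nnegrE ?(ltW u0).
Qed.

(** The error has fewer than [m] sums, each over at most [m] of the last indices. *)
Lemma truncation_error_le N e u : (m <= N)%N -> 0 <= e -> y <= u <= 1 ->
  (forall n s, (N - m <= n)%N -> 0 <= s -> `|k_ s n| <= e) ->
  `|truncation_error m f lambda t N u| <= m%:R * (m%:R * e).
Proof.
move=> mN e0 /andP[yu u1] ke; have u0 := ltW (lt_le_trans (expR_gt0 _) yu).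
have X1 n : `|u ^+ n| <= 1 by rewrite normrX exprn_ile1// ger0_norm.
apply: (le_trans (ler_norm_sum _ _ _)).
apply: (@le_trans _ _ (\sum_(1 <= i < m) m%:R * e)); last first.
  by rewrite sumr_const_nat [leRHS]mulr_natl; apply: ler_wpMn2l; rewrite ?mulr_ge0 ?leq_subr.
rewrite big_nat [leRHS]big_nat; apply: ler_sum => i im.
rewrite normrM -[leRHS]mul1r ler_pM//.
  rewrite normrM -[leRHS]mul1r ler_pM// ger0_norm ?(bundle_tail_ge0 hf)//.
  exact: bundle_tail_le1 hf i.
apply: (le_trans (ler_norm_sum _ _ _)).
apply: (@le_trans _ _ (\sum_(n < N.+1 | (N.+1 - m <= n)%N) e)).
  rewrite big_mkcond [leRHS]big_mkcond/=; apply: ler_sum => n _.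
  case: ifP => Nn; last by case: ifP.
  rewrite ifT; last by lia.
  rewrite normrM -[leRHS]mulr1 ler_pM//; apply: ke; first by lia.
  exact: clock_ge0.
rewrite sumr_const mulr_natl; apply: ler_wpMn2l => //.
rewrite -sum1_card -(big_mkord (fun n => N.+1 - m <= n)%N (fun=> 1%N)).
rewrite (big_cat_nat _ (leq_subr m N.+1))//= big_nat_cond big1 => [|n]; last lia.
rewrite add0n; apply: (@leq_trans (\sum_(N.+1 - m <= n < N.+1) 1)%N).
  by rewrite big_mkcond leq_sum// => n _; case: ifP.
by rewrite sum_nat_const_nat; lia.
Qed.

(** At [u = 1] the sum of the second differences telescopes. *)
Lemma curvature_poly1 N : (m < N)%N ->
  curvature_poly m f lambda t N 1 = rho t N - rho t N.-1.
Proof.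
move=> mN; rewrite /curvature_poly /clock ln1 mul0r addr0.
have T (a : nat -> R) K : \sum_(n < K.+1) bdiff a n * 1 ^+ n = a K.
  elim: K => [|K IH]; first by rewrite big_ord1 expr0 mulr1 /bdiff /nshift subr0.
  by rewrite big_ord_recr/= IH expr1n mulr1 /bdiff /nshift subn1/= addrC subrK.
rewrite /curvature T /bdiff /nshift; case: N mN => [//|N] mN /=.
by rewrite subn1 /long_mean /= (ltnW mN) -ltnS mN.
Qed.

Lemma curvature_poly_start N : (m < N)%N ->
  curvature_poly m f lambda t N y = m%:R * y ^+ m - (m%:R - 1) * y ^+ m.+1.
Proof.
move=> mN; rewrite /curvature_poly /clock expRK mulNr mulrAC divff ?gt_eqF// mul1r subrr.
under eq_bigr do rewrite curvature_at0 mulrBl.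
have E c a : (c < N.+1)%N -> \sum_(n < N.+1) a * (n == c :> nat)%:R * y ^+ n = a * y ^+ c.
  move=> cN; rewrite (bigD1 (Ordinal cN))//= eqxx mulr1 big1 ?addr0// => n nc.
  by rewrite (_ : (_ == _) = false) ?mulr0 ?mul0r//; apply/negbTE.
by rewrite sumrB !E//; lia.
Qed.

Lemma damping1 : damping 1 = 1.
Proof. by rewrite /damping ln1 mulr0 subrr mulr0 expR0 mulr1. Qed.

Lemma damping_start : damping y * (m%:R * y ^+ m - (m%:R - 1) * y ^+ m.+1) =
  (m%:R - (m%:R - 1) * y) *
   expR (2 * (phi y - phi 1) - lambda * t * (m%:R - derive1 phi 1)).
Proof.
rewrite derive1_varphi1 /damping expRK; set P := phi y - phi 1.
have -> : 2 * P - lambda * t * (m%:R - tau) =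
  - tau * - (lambda * t) + 2 * P + m%:R * - (lambda * t) by ring.
by rewrite 2!expRD [expR (m%:R * _)]expRM_natl exprSr; ring.
Qed.

(** Integrating [is_derive_potential] between [u = expR (- (lambda * t))] and
    [u = 1]: the flux gives the integral in [alpha], the initial value gives its
    last term, and the truncation error vanishes with the last coefficients. *)
Lemma cvg_gap_increment :
  rho t n.+1 - rho t n @[n --> \oo] --> 1 - alpha m f rho t lambda.
Proof.
have [C C0 HC] := drift_factor_bound.
have intE : \int[lebesgue_measure]_(u in `[y, 1])
      (expR (2 * (phi u - phi 1)) * q_hat m f rho (t + ln u / lambda) u) =
    \int[lebesgue_measure]_(u in `[y, 1]) potential_drift (2 * m) u.
  apply: eq_Rintegral => u; rewrite inE/= in_itv/= => /andP[yu _].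
  have u0 := lt_le_trans (expR_gt0 _) yu.
  by rewrite /potential_drift (flux_source t hm hf lambda0 u0 (leqnn _)).
rewrite /alpha intE -damping_start; set I := Rintegral _ _ _.
set W := damping y * _.
have -> : 1 - (1 - I - W) = I + W by ring.
apply/cvgrPdist_le => e e0.
(* Coefficients below [d] make the truncation error, times [2 * C], at most [e]. *)
pose d := e / (2 * C * m%:R * m%:R).
have m0 : 0 < m%:R :> R by rewrite ltr0n.
have d0 : 0 < d by rewrite divr_gt0// !mulr_gt0.
have [N0 HN0] := curvature_vanishes hm hf lambda0 d0.
near=> n.
have nN : (N0 + 2 * m + m <= n)%N by near: n; exact: nbhs_infty_ge.
have yu0 u : y <= u <= 1 -> 0 < u by move=> /andP[yu _]; exact: lt_le_trans (expR_gt0 _) yu.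
have nm : (2 * m <= n.+1)%N by lia.
have := @FTC_approx R (fun u => damping u * curvature_poly m f lambda t n.+1 u)
  (fun u => damping u / u * (2 * (1 - u) * (\sum_(j < n.+2) src (clock u) j * u ^+ j)
      + 2 * truncation_error m f lambda t n.+1 u)) (potential_drift (2 * m)) y 1 e y_lt1.
rewrite damping1 mul1r curvature_poly1 ?curvature_poly_start -/W /=; [|lia..].
move=> H; have {}H : `|rho t n.+1 - rho t n - W - I| <= e * (1 - y).
  apply: H.
  - by move=> u uy; exact: (is_derive_potential t hm hf lambda0 (yu0 _ uy) nm).
  - apply: continuous_pt_within => u /yu0 u0; apply: continuous_ptM.
      exact: continuous_drift_factor.
    apply: continuous_ptD.
      apply: continuous_ptM.
        apply: continuous_ptM; first exact: continuous_pt_cst.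
        by apply: cvgB; [exact: cvg_cst|exact: cvg_id].
      apply: continuous_pt_sum => j; apply: continuous_ptM; first exact: continuous_source.
      exact: continuous_pt_exp.
    apply: continuous_ptM; first exact: continuous_pt_cst.
    exact: continuous_truncation_error.
  - by apply: continuous_pt_within => u /yu0 u0; exact: continuous_potential_drift.
  - move=> u uy; have u0 := yu0 _ uy.
    rewrite mulrDr (flux_source t hm hf lambda0 u0 nm).
    rewrite /potential_drift (flux_source t hm hf lambda0 u0 (leqnn _)) addrC addKr.
    have /andP[F0 FC] := HC _ uy.
    rewrite normrM (ger0_norm F0).
    apply: (@le_trans _ _ (C * (2 * (m%:R * (m%:R * d))))).
      apply: ler_pM => //; rewrite normrM normr_nat ler_wpM2l//.
      apply: truncation_error_le => //; [lia|exact: ltW|].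
      by move=> j s jn s0; apply: HN0 => //; lia.
    rewrite /d le_eqVlt; apply/orP; left; apply/eqP; field.
    by rewrite !gt_eqF.
rewrite distrC; have -> : rho t n.+1 - rho t n - (I + W) = rho t n.+1 - rho t n - W - I by ring.
apply: (le_trans H); rewrite ger_pMr// lerBlDr lerDl expR_ge0//.
Unshelve. all: by end_near. Qed.

End gap_growth.

(** * Densities *)

Section densities.
Variables (R : realType) (m : nat) (f : nat -> R) (lambda t : R).
Hypotheses (hm : (0 < m)%N) (hf : is_bundle_pmf m f) (lambda0 : 0 < lambda).

Local Notation rho := (gap_mean m f lambda).
Local Notation circle := (circle_mean m f lambda).

Lemma cvg_bounded_over_n (a : nat -> R) B : (forall n, `|a n| <= B) ->
  a n / n.+1%:R @[n --> \oo] --> (0 : R).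
Proof.
move=> aB; apply/cvgrPdist_le => e e0.
have : B * n.+1%:R^-1 @[n --> \oo] --> (B * 0 : R).
  by apply: cvgMl_tmp; exact: cvg_harmonic.
rewrite mulr0 => /cvgrPdist_le /(_ _ e0); apply: filterS => n.
rewrite !sub0r !normrN normrM [in X in _ -> X]normrM => /(le_trans _); apply.
by rewrite ler_wpM2r// (le_trans (aB n))// ler_norm.
Qed.

Lemma pmf_average_le (F : nat -> R) B :
  (forall b, (b < m)%N -> `|F b| <= B) -> `|\sum_(b < m) f b.+1 * F b| <= B.
Proof.
move=> FB; apply: (le_trans (ler_norm_sum _ _ _)).
rewrite -[leRHS]mul1r -(sum_pmf_ord hf) mulr_suml; apply: ler_sum => b _.
have f0 : 0 <= f b.+1 by case: hf.
by rewrite normrM (ger0_norm f0) ler_wpM2l// FB.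
Qed.

Lemma pmf_averageB (F : nat -> R) c :
  \sum_(b < m) f b.+1 * (F b - c) = \sum_(b < m) f b.+1 * F b - c.
Proof.
under eq_bigr do rewrite mulrBr.
by rewrite sumrB -mulr_suml (sum_pmf_ord hf) mul1r.
Qed.

Hypothesis t0 : 0 < t.

Lemma cvg_gap_density :
  rho t n.+1 / n.+1%:R @[n --> \oo] --> 1 - alpha m f rho t lambda.
Proof.
have := cesaro (cvg_gap_increment hm hf lambda0 t0).
rewrite (_ : arithmetic_mean _ = fun n => rho t n.+1 / n.+1%:R)//.
apply/funext => n; rewrite /arithmetic_mean /= /series/= telescope_sumr// gap_mean_len0 subr0.
by rewrite mulrC.
Qed.

(** The difference is damped at rate [lambda * n.+1] and forced by the drifts, which
    are at most [lambda * n.+1 * m]. *)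
Lemma circle_mean_near n : (m <= n.+1)%N ->
  `|circle n t - \sum_(b < m) f b.+1 * rho t (n - b)| <= m%:R.
Proof.
move=> mn; have n0 : 0 < n.+1%:R :> R by rewrite ltr0n.
have a0 : 0 < lambda * n.+1%:R by rewrite mulr_gt0.
have E : m%:R = lambda * n.+1%:R * m%:R / (lambda * n.+1%:R) :> R.
  by rewrite mulrC mulKf// gt_eqF.
rewrite [leRHS]E.
apply: (@linear_decay _ (fun s => circle n s - \sum_(b < m) f b.+1 * rho s (n - b))
  (fun s => - \sum_(b < m) f b.+1 * gap_drift m f lambda s (n - b))) => //.
- exact: ltW.
- move=> s.
  have D1 := is_derive_circle_mean hf lambda0 hm mn s.
  have D2 (b : 'I_m) := is_derive_scalef (f b.+1) (is_derive_gap_mean hf lambda0 s (n - b)).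
  have D3 := @is_derive_sumf R 'I_m (index_enum _) xpredT
    (fun b s => f b.+1 * rho s (n - b)) _ s (fun b _ => D2 b).
  have D4 := is_derive_subf D1 D3.
  apply: (is_derive_rewrite D4).
  ring.
- move=> s /andP[s0 _]; rewrite normrN; apply: (pmf_average_le (F := fun b => gap_drift m f lambda s (n - b))) => b bm.
  apply: (le_trans (gap_drift_bounded hf lambda0 _ s0)).
  by rewrite ler_wpM2r// (ler_wpM2l (ltW lambda0))// ler_nat; lia.
- rewrite -E circle_mean_at0.
  under eq_bigr do rewrite gap_mean_at0.
  rewrite distrC -(pmf_averageB (fun b => (n - b)%:R)).
  apply: (pmf_average_le (F := fun b => (n - b)%:R - n.+1%:R)) => b bm.
  by rewrite distrC -natrB ?ger0_norm ?ler_nat//; lia.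
Qed.

(** The increments of [rho t] being bounded, the average of the [rho t (n - b)]
    stays at bounded distance from [rho t n.+1]. *)
Lemma cvg_circle_density :
  circle n t / n.+1%:R @[n --> \oo] --> 1 - alpha m f rho t lambda.
Proof.
have cu := cvg_gap_increment hm hf lambda0 t0.
have [K [_ HK]] := cvg_seq_bounded (cvgP _ cu).
have {}HK n : `|rho t n.+1 - rho t n| <= K + 1 by apply: HK => //; rewrite ltrDl.
have K0 : 0 <= K + 1 by apply: le_trans (HK 0%N).
have step n b : (b <= n)%N -> `|rho t n.+1 - rho t (n - b)| <= b.+1%:R * (K + 1).
  elim: b => [|b IH] bn; first by rewrite subn0 mul1r.
  have {}IH := IH (ltnW bn).
  rewrite -(subrKA (rho t (n - b))); apply: (le_trans (ler_normD _ _)).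
  rewrite -[b.+2%:R]natr1 mulrDl mul1r lerD//.
  by have := HK (n - b.+1)%N; rewrite -subSn// subSS.
have near n : (m <= n.+1)%N -> `|circle n t - rho t n.+1| <= m%:R + m%:R * (K + 1).
  move=> mn; rewrite -(subrKA (\sum_(b < m) f b.+1 * rho t (n - b))).
  apply: (le_trans (ler_normD _ _)); rewrite lerD ?circle_mean_near//.
  rewrite -(pmf_averageB (fun b => rho t (n - b))).
  apply: (pmf_average_le (F := fun b => rho t (n - b) - rho t n.+1)) => b bm.
  rewrite distrC (le_trans (step _ _ _))//; first lia.
  by rewrite ler_wpM2r// ler_nat.
pose a n : R := if (m <= n.+1)%N then circle n t - rho t n.+1 else 0.
have aB n : `|a n| <= m%:R + m%:R * (K + 1).
  by rewrite /a; case: ifP => [/near//|_]; rewrite normr0 addr_ge0// mulr_ge0.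
have H : a n / n.+1%:R + rho t n.+1 / n.+1%:R @[n --> \oo] -->
    0 + (1 - alpha m f rho t lambda).
  by apply: cvgD; [exact: cvg_bounded_over_n aB|exact: cvg_gap_density].
rewrite add0r in H; apply: (cvg_trans _ H); apply: near_eq_cvg; near=> n.
rewrite /a ifT; last by near: n; exists m => // n /= mn; exact: leqW.
by rewrite -mulrDl subrK.
Unshelve. all: by end_near. Qed.

End densities.

Theorem theorem3p3 (R : realType) (m : nat) (f : nat -> R) (lambda t : R)
    (hm : (0 < m)%N) (hf : is_bundle_pmf m f) (hlambda : 0 < lambda)
    (ht : 0 <= t)
    (L C : forall n : nat, request_model n lambda f) :
  let remaining := fun (s : R) (i : nat) => line_remaining (L i) s in
  ((fun n : nat => line_picked (L n) t / n%:R) @ \oo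
     --> alpha m f remaining t lambda) /\
  ((fun n : nat => circle_picked (C n) t / n%:R) @ \oo
     --> alpha m f remaining t lambda).
Proof.
move=> remaining; pose rho := gap_mean m f lambda.
have lineE n s : 0 <= s -> line_picked (L n) s = n%:R - rho s n.
  by move=> s0; rewrite /line_picked (expected_picked_upE hf) // line_mean.
have circleE n : circle_picked (C n.+1) t = n.+1%:R - circle_mean m f lambda n t.
  by rewrite /circle_picked (expected_picked_upE hf).
have alphaE : alpha m f remaining t lambda = alpha m f rho t lambda.
  rewrite /alpha; congr (_ - _ - _); apply: eq_Rintegral => u.
  rewrite inE/= in_itv/= => /andP[yu _]; congr (_ * _).
  have s0 : 0 <= t + ln u / lambda by exact: clock_ge0 yu.
  rewrite /q_hat; set s := t + _ in s0 *.
  have E i : remaining s i = rho s i.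
    by rewrite /remaining /line_remaining lineE// opprB addrC subrK.
  by under eq_bigr do rewrite E; under [in X in _ - X]eq_bigr do rewrite E.
rewrite alphaE.
have to_limit (a : nat -> R) (l : R) : a n.+1 / n.+1%:R @[n --> \oo] --> l ->
    a n / n%:R @[n --> \oo] --> l.
  by move=> al; rewrite -cvg_shiftS.
have complement (a : nat -> R) (l : R) : a n / n.+1%:R @[n --> \oo] --> 1 - l ->
    (n.+1%:R - a n) / n.+1%:R @[n --> \oo] --> l.
  move=> al; rewrite -[l](subKr 1).
  rewrite (_ : (fun n => _) = fun n => 1 - a n / n.+1%:R).
    by apply: cvgB => //; exact: cvg_cst.
  by apply/funext => n; rewrite mulrBl divff// pnatr_eq0.
move: ht; rewrite le_eqVlt => /predU1P[t0|t0]; last first.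
  split; apply: to_limit.
    under eq_fun do rewrite lineE ?(ltW t0)//.
    exact/complement/cvg_gap_density.
  under eq_fun do rewrite circleE.
  exact/complement/cvg_circle_density.
have -> : alpha m f rho t lambda = 0.
  rewrite /alpha -t0 mulr0 oppr0 expR0 set_itv1 Rintegral_set1 subrr mulr0 !mul0r.
  by rewrite subrr expR0 !mulr1 subr0; ring.
split; apply: to_limit.
  rewrite (_ : (fun n => _) = fun=> 0); first exact: cvg_cst.
  apply/funext => n; rewrite lineE -t0// /rho gap_mean_at0.
  by rewrite subrr mul0r.
rewrite (_ : (fun n => _) = fun=> 0); first exact: cvg_cst.
apply/funext => n; rewrite circleE -t0 circle_mean_at0.
by rewrite subrr mul0r.
Qed.
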